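(* For any $k\le0$ and any $i$ which is not a loop or coloop of $L$, there is an exact sequence $$0\to\mathcal{C}_{L\setminus i,k}^{\bullet-1,\bullet}\to\mathcal{C}_{L,k}^{\bullet,\bullet}\to\mathcal{C}_{L/i,k}^{\bullet,\bullet}\oplus\mathcal{C}_{L/i,k}^{\bullet,\bullet-1},$$ with the maps described in the context. If $k\in\{-1,0\}$, then this sequence is right exact (i.e. the last map is surjective).
   Context: Let $L$ be a complex vector space of dimension $r$, and let $\ell_1,\dots,\ell_n \in L^*$ be linear forms (possibly zero, possibly proportional) with zero loci $H_1,\dots,H_n$ satisfying $H_1\cap\dots\cap H_n=0$. An index $i$ is a loop if $\ell_i=0$, and a coloop if $\bigcap_{j\ne i}H_j\ne0$. If $i$ is not a loop or coloop: the contraction $L/i$ is the space $H_i$ with the arrangement given by $\ell_j|_{H_i}$, $j\neq i$; the deletion $L\setminus i$ is the space $L$ with the arrangement given by $\ell_j$, $j\ne i$. Superspace: $\Psi_L=\operatorname{Sym}L\otimes\wedge^\bullet L$, bigraded by (commutative degree, anticommutative degree), with derivation $d$ (exterior derivative) of bidegree $(-1,1)$ with $d(v\otimes1)=1\otimes v$, $d(1\otimes v)=0$ for $v\in L$. $\Psi_{L^*}=\operatorname{Sym}L^*\otimes\wedge^\bullet L^*$ is the space of polynomial differential forms on $L$, similarly bigraded. $\Psi_L$ acts on $\Psi_{L^*}$ (action $\odot$): $v\otimes 1$ acts by the directional derivative $D_v$ on coefficients, $1\otimes v$ acts by contraction $\iota_v$. The inverse system of a bigraded ideal $I\subseteq\Psi_L$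 is $\{g\in\Psi_{L^*}: f\odot g=0\text{ for all }f\in I\}$. The differential closure of a homogeneous ideal of $\operatorname{Sym}L$ is the smallest ideal of $\Psi_L$ containing it and closed under $d$. For $v\in L$, $\rho(v)$ is the number of hyperplanes $H_i$ (counted with index) not containing $v$. The ideal of the $k$th zonotopal algebra is $(v^{\rho(v)+k+1}:v\in L\setminus\{0\})\subseteq\operatorname{Sym}L$, the unit ideal if some nonzero $v$ has $\rho(v)+k+1\le0$. $\mathcal{C}_{L,k}\subseteq\Psi_{L^*}$ is the inverse system of the differential closure of this ideal, with its bigrading $\mathcal{C}_{L,k}=\bigoplus_{a,b}\mathcal{C}_{L,k}^{a,b}$; $\mathcal{C}_{L\setminus i,k}\subseteq\Psi_{L^*}$ and $\mathcal{C}_{L/i,k}\subseteq\Psi_{(L/i)^*}$ are defined in the same way for the arrangements $L\setminus i$ and $L/i$. Maps: the first map is multiplication by $\ell_i$, a linear form with zero locus $H_i$. Choose a splitting $L\cong L/i\oplus\mathbb{C}\cdot v$ of the inclusion $L/i=H_i\hookrightarrow L$. The map $\mathcal{C}_{L,k}^{\bullet,\bullet}\to\mathcal{C}_{L/i,k}^{\bullet,\bullet}$ is restriction of differential forms to $H_i$; the map $\mathcal{C}_{L,k}^{\bullet,\bullet}\to\mathcal{C}_{L/i,k}^{\bullet,\bullet-1}$ is contraction with $v$ followed by restriction to $H_i$ (it depends on the splitting). *)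

(* Defs.v *)
From HB Require Import structures.
From mathcomp Require Import all_boot all_order all_algebra.
From mathcomp Require Import mpoly complex.
From mathcomp Require Import reals.

Set Implicit Arguments.
Unset Strict Implicit.
Unset Printing Implicit Defensive.

Import Order.TTheory GRing.Theory Num.Theory.
Local Open Scope ring_scope.

(** * Superspace in coordinates *)

(* [superspace K r] is K[x_1..x_r] (x) /\(t_1..t_r): [f] stands for the sum,
   over subsets S = {s_1 < .. < s_p} of 'I_r, of f S (x) t_{s_1} /\ .. /\ t_{s_p}. *)
Definition superspace (K : fieldType) (r : nat) := {ffun {set 'I_r} -> {mpoly K[r]}}.

(* t_A /\ t_B = (-1) ^ inversions A B * t_(A :|: B) when A and B are disjoint. *)
Definition inversions (r : nat) (A B : {set 'I_r}) : nat :=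
  #|[set p in setX A B | (p.2 < p.1)%N]|.

Definition sup_mul (K : fieldType) (r : nat) (f g : superspace K r) :
    superspace K r :=
  [ffun S : {set 'I_r} => \sum_(A in powerset S)
     (-1) ^+ inversions A (S :\: A) *: (f A * g (S :\: A))].

Definition sup_sym (K : fieldType) (r : nat) (p : {mpoly K[r]}) : superspace K r :=
  [ffun S : {set 'I_r} => if S == set0 then p else 0].

Definition sym1 (K : fieldType) (r : nat) (c : 'I_r -> K) : {mpoly K[r]} :=
  \sum_j c j *: 'X_j.

Definition ext1 (K : fieldType) (r : nat) (c : 'I_r -> K) : superspace K r :=
  [ffun S : {set 'I_r} => \sum_(j | S == [set j]) (c j)%:MP].

(* d (p (x) t_S) = \sum_j (dp/dx_j) (x) (t_j /\ t_S). *)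
Definition sup_d (K : fieldType) (r : nat) (f : superspace K r) : superspace K r :=
  [ffun S : {set 'I_r} => \sum_(j in S)
     (-1) ^+ inversions [set j] (S :\ j) *: (f (S :\ j))^`M(j)].

Definition contract_coord (K : fieldType) (r : nat) (j : 'I_r) (g : superspace K r) :
    superspace K r :=
  [ffun S : {set 'I_r} => if j \in S then 0
             else (-1) ^+ inversions [set j] S *: g (j |: S)].

(* The operator p(d/dx_1, .., d/dx_r). *)
Definition diff_op (K : fieldType) (r : nat) (p q : {mpoly K[r]}) : {mpoly K[r]} :=
  \sum_(m <- msupp p) p@_m *: q^`M[m].

(* The action in which x_j (x) 1 acts by d/dx_j on coefficients, 1 (x) t_j by
   contraction, and a product by composition; [enum S] is increasing. *)
Definition odot (K : fieldType) (r : nat) (f g : superspace K r) : superspace K r :=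
  [ffun T : {set 'I_r} => \sum_(S : {set 'I_r})
     diff_op (f S) (foldr (@contract_coord K r) g (enum S) T)].

Definition bihomogeneous (K : fieldType) (r : nat) (a b : int) (g : superspace K r) :
    Prop :=
  forall (S : {set 'I_r}) (m : 'X_{1..r}), (g S)@_m != 0 ->
    (mdeg m)%:Z = a /\ (#|S|)%:Z = b.

(** * Ideals *)

Definition sym_ideal (K : fieldType) (r : nat) (J : {mpoly K[r]} -> Prop) : Prop :=
  [/\ J 0, forall p q, J p -> J q -> J (p + q) & forall p q, J q -> J (p * q)].

Definition sym_ideal_gen (K : fieldType) (r : nat) (G : {mpoly K[r]} -> Prop)
    (p : {mpoly K[r]}) : Prop :=
  forall J, sym_ideal J -> (forall q, G q -> J q) -> J p.

Definition sup_ideal (K : fieldType) (r : nat) (J : superspace K r -> Prop) : Prop :=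
  [/\ J 0, forall f g, J f -> J g -> J (f + g),
      forall f g, J g -> J (sup_mul f g) & forall f g, J g -> J (sup_mul g f)].

Definition diff_closure (K : fieldType) (r : nat) (I : {mpoly K[r]} -> Prop)
    (f : superspace K r) : Prop :=
  forall J, sup_ideal J -> (forall g, J g -> J (sup_d g)) ->
    (forall p, I p -> J (sup_sym p)) -> J f.

Definition inverse_system (K : fieldType) (r : nat) (I : superspace K r -> Prop)
    (g : superspace K r) : Prop :=
  forall f, I f -> odot f g = 0.

(** * Superspace of a vector space *)

(* Vectors are expanded in the basis (e_j) = [vbasis fullv], linear forms in its
   dual basis: x_j, t_j stand for e_j in [Psi V] and for e_j^* in [Psi_dual V], so
   that the elements of [Psi_dual V] are the polynomial differential forms on V
   and t_j is the differential of the j-th coordinate. *)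
Definition Psi (K : fieldType) (V : vectType K) := superspace K (\dim {:V}).
Definition Psi_dual (K : fieldType) (V : vectType K) := superspace K (\dim {:V}).

Definition vcoord (K : fieldType) (V : vectType K) (v : V) : 'I_(\dim {:V}) -> K :=
  fun j => coord (vbasis {:V}) j v.

Definition form_coord (K : fieldType) (V : vectType K) (l : 'Hom(V, K^o)) :
    'I_(\dim {:V}) -> K :=
  fun j => l (tnth (vbasis {:V}) j).

Definition contract (K : fieldType) (V : vectType K) (v : V) (g : Psi_dual V) :
    Psi_dual V :=
  [ffun S : {set 'I_(\dim {:V})} => \sum_j vcoord v j *: contract_coord j g S].

Definition mul_form (K : fieldType) (V : vectType K) (l : 'Hom(V, K^o))
    (g : Psi_dual V) : Psi_dual V :=
  sup_mul (sup_sym (sym1 (form_coord l))) g.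

(* Coordinates on W of the j-th coordinate form of V composed with phi. *)
Definition pullback_coord (K : fieldType) (W V : vectType K) (phi : 'Hom(W, V))
    (j : 'I_(\dim {:V})) : 'I_(\dim {:W}) -> K :=
  fun k => vcoord (phi (tnth (vbasis {:W}) k)) j.

Definition pullback (K : fieldType) (W V : vectType K) (phi : 'Hom(W, V))
    (g : Psi_dual V) : Psi_dual W :=
  \sum_(S : {set 'I_(\dim {:V})})
    sup_mul
      (sup_sym (g S \mPo [tuple sym1 (pullback_coord phi j) | j < \dim {:V}]))
      (\big[@sup_mul K _/sup_sym 1]_(j in S) ext1 (pullback_coord phi j)).

Definition incl (K : fieldType) (V : vectType K) (U : {vspace V}) :
    'Hom(subvs_of U, V) :=
  linfun vsval.

Definition restrict_form (K : fieldType) (V : vectType K) (U : {vspace V})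
    (g : Psi_dual V) : Psi_dual (subvs_of U) :=
  pullback (incl U) g.

(** * Arrangements *)

Definition arrangement (K : fieldType) (V : vectType K) (n : nat) :=
  'I_n -> 'Hom(V, K^o).

Definition hyp (K : fieldType) (V : vectType K) (n : nat) (l : arrangement V n)
    (i : 'I_n) : {vspace V} :=
  lker (l i).

Definition essential (K : fieldType) (V : vectType K) (n : nat)
    (l : arrangement V n) : Prop :=
  (\bigcap_i hyp l i)%VS = 0%VS.

Definition loop (K : fieldType) (V : vectType K) (n : nat) (l : arrangement V n)
    (i : 'I_n) : Prop :=
  l i = 0.

Definition coloop (K : fieldType) (V : vectType K) (n : nat) (l : arrangement V n)
    (i : 'I_n) : Prop :=
  (\bigcap_(j | j != i) hyp l j)%VS <> 0%VS.

Definition deletion (K : fieldType) (V : vectType K) (n : nat) (l : arrangement V n)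
    (i : 'I_n) : arrangement V n.-1 :=
  fun j => l (lift i j).

Definition contraction (K : fieldType) (V : vectType K) (n : nat)
    (l : arrangement V n) (i : 'I_n) : arrangement (subvs_of (hyp l i)) n.-1 :=
  fun j => (l (lift i j) \o incl (hyp l i))%VF.

Definition rho (K : fieldType) (V : vectType K) (n : nat) (l : arrangement V n)
    (v : V) : nat :=
  #|[set i | v \notin hyp l i]|.

(* An exponent e <= 0 is truncated to 0, and the generator 1 then gives the unit
   ideal. *)
Definition power_gen (K : fieldType) (V : vectType K) (v : V) (e : int) :
    {mpoly K[\dim {:V}]} :=
  if 0 <= e then sym1 (vcoord v) ^+ `|e|%N else 1.

Definition zonotopal_ideal (K : fieldType) (V : vectType K) (n : nat)
    (l : arrangement V n) (k : int) : {mpoly K[\dim {:V}]} -> Prop :=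
  sym_ideal_gen
    (fun p => exists2 v : V, v != 0 & p = power_gen v ((rho l v)%:Z + k + 1)).

Definition zonotopal_C (K : fieldType) (V : vectType K) (n : nat)
    (l : arrangement V n) (k : int) (g : Psi_dual V) : Prop :=
  inverse_system (diff_closure (zonotopal_ideal l k) : Psi V -> Prop) g.

Definition zonotopal_Cab (K : fieldType) (V : vectType K) (n : nat)
    (l : arrangement V n) (k a b : int) (g : Psi_dual V) : Prop :=
  zonotopal_C l k g /\ bihomogeneous a b g.

(** * Exactness for maps restricted to subgroups *)

Definition dsum (U V : Type) (A : U -> Prop) (B : V -> Prop) (p : U * V) : Prop :=
  A p.1 /\ B p.2.

Definition left_exact (U V W : zmodType) (A : U -> Prop) (B : V -> Prop)
    (D : W -> Prop) (f : U -> V) (g : V -> W) : Prop :=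
  [/\ forall x, A x -> B (f x),
      forall y, B y -> D (g y),
      forall x x', A x -> A x' -> f x = f x' -> x = x' &
      forall y, B y -> (g y = 0 <-> exists2 x, A x & f x = y)].

Definition onto (V W : Type) (B : V -> Prop) (D : W -> Prop) (g : V -> W) : Prop :=
  forall z, D z -> exists2 y, B y & g y = z.

(* Main.v *)
(** In terms of polynomial forms, C_{L,k} consists of the forms g such that for all
    v <> 0 the degree of g along v is at most rho(v) + k, where the differential of
    the coordinate along v has degree one: indeed d(v^m) = m v^(m-1) dv. With this
    description, left exactness is division by l_i.

    For k = 0, an induction based on left exactness shows that C_{L,0} is spanned by
    the products of some of the l_j and the differentials of other ones, and these
    products extend from H_i to L.

    For k = -1 there is no such spanning set, and right exactness is deduced from the
    case k = 0. For a generic linear form b, multiplication by b identifies C_{L,-1}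
    with the forms in C_{L,0} that restrict to zero on ker b together with their
    contraction by a vector outside ker b. If only the restriction is zero, then the
    restricted contraction lies in C_{ker b,-1}, and all elements of this space
    arise; this last fact is proved by induction on the number of hyperplanes. *)

Require Import Defs.
From HB Require Import structures.
From mathcomp Require Import all_boot all_order all_algebra.
From mathcomp Require Import mpoly ssrcomplements complex.
From mathcomp Require Import reals ring.

Set Implicit Arguments.
Unset Strict Implicit.
Unset Printing Implicit Defensive.

Import Order.TTheory GRing.Theory Num.Theory.
Local Open Scope ring_scope.

(** * Operators on superspace *)

(** A form that vanishes on a hyperplane together with its contraction by a transversal vector is
    divisible by the equation of the hyperplane; this is used for H_i and for ker b. Characteristic
    zero inverts the m in d(v^m), makes this division lower degrees as expected, and provides a
    generic b. Division by b gains the degree that separates C_{L,-1} from C_{L,0}. This is clear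
    along w if b(w) <> 0. If b(w) = 0 and w <> 0, some u in the smallest flat containing w has b(u)
    <> 0, and derivation or contraction by u already lowers the degree bound along w. The obstacle
    at k = -1 is that a lift to C_{L,0} of b times a form on H_i need not be divisible by b. The
    defect is a form on ker b and a multiple of l_i there; removing it requires that the quotient be
    a restricted contraction for the deletion. Restriction to a hyperplane becomes pullback along a
    projection, so that all arrangements stay in one space. The projected lists are not essential,
    hence the maximum with 1 in the exponent for k = -1. *)

Section Inversions.

Variable r : nat.
Implicit Types (j k : 'I_r) (A B S : {set 'I_r}).

Lemma inversionsE A B : inversions A B = (\sum_(j in A) \sum_(q in B) (q < j))%N.
Proof.
rewrite pair_big_dep /inversions -sum1_card [RHS]big_mkcond [LHS]big_mkcond /=.
apply: eq_bigr => -[a b] _; rewrite !inE /=.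
by case: (a \in A) (b \in B) => [] [] //=; case: ltnP.
Qed.

Lemma inversions1E j S : inversions [set j] S = (\sum_(q in S) (q < j))%N.
Proof. by rewrite inversionsE big_set1. Qed.

Lemma inversions0s S : inversions set0 S = 0.
Proof. by rewrite inversionsE big_set0. Qed.

Lemma inversions_setU1 j k S : k \notin S ->
  inversions [set j] (k |: S) = ((k < j) + inversions [set j] S)%N.
Proof. by move=> kS; rewrite !inversions1E big_setU1. Qed.

Lemma inversions_setU1l j A B : j \notin A ->
  inversions (j |: A) B = (inversions [set j] B + inversions A B)%N.
Proof. by move=> jA; rewrite !inversionsE big_setU1 ?big_set1. Qed.

Lemma inversions_setD1 j k S : k \in S ->
  inversions [set j] S = ((k < j) + inversions [set j] (S :\ k))%N.
Proof. by move=> kS; rewrite -{1}(setD1K kS) inversions_setU1 // !inE eqxx. Qed.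

Lemma setU1_setD1C j k S : j != k -> (j |: S) :\ k = j |: (S :\ k).
Proof.
move=> njk; apply/setP=> q; rewrite !inE.
by case: (q =P k) => [->|//]; rewrite eq_sym (negPf njk).
Qed.

Lemma setD1C j k S : S :\ j :\ k = S :\ k :\ j.
Proof. by apply/setP=> q; rewrite !inE andbCA. Qed.

Lemma sign_ltn_swap (R : nzRingType) j k : j != k ->
  (-1) ^+ (j < k)%N = - (-1) ^+ (k < j)%N :> R.
Proof.
by rewrite -val_eqE; case: ltngtP => //= _ _; rewrite !(expr0, expr1) ?opprK.
Qed.

End Inversions.

HB.instance Definition _ (K : fieldType) (r : nat) :=
  GRing.Lmodule.copy (superspace K r) {ffun {set 'I_r} -> {mpoly K[r]}}.

Section CoordinateOperators.

Variables (K : fieldType) (r : nat).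
Implicit Types (f g h : superspace K r) (j k : 'I_r) (S T : {set 'I_r}).
Implicit Types (p q : {mpoly K[r]}).

Definition pmul p g : superspace K r := [ffun S => p * g S].

Definition deriv_coord j g : superspace K r := [ffun S => (g S)^`M(j)].

Definition wedge_coord j g : superspace K r :=
  [ffun S : {set 'I_r} => if j \in S then (-1) ^+ inversions [set j] (S :\ j) *: g (S :\ j)
             else 0].

Definition sup1 : superspace K r := sup_sym 1.

Lemma pmul_is_linear p : linear (pmul p).
Proof. by move=> c f g; apply/ffunP=> S; rewrite !ffunE mulrDr scalerAr. Qed.

HB.instance Definition _ p :=
  GRing.isLinear.Build K (superspace K r) (superspace K r) _ (pmul p)
    (pmul_is_linear p).

Lemma pmulD p f g : pmul p (f + g) = pmul p f + pmul p g.
Proof. exact: linearD. Qed.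

Lemma pmulB p f g : pmul p (f - g) = pmul p f - pmul p g.
Proof. exact: linearB. Qed.

Lemma pmul0 p : pmul p 0 = 0.
Proof. exact: linear0. Qed.

Lemma deriv_coord_is_linear j : linear (deriv_coord j).
Proof. by move=> c f g; apply/ffunP=> S; rewrite !ffunE linearP. Qed.

HB.instance Definition _ j :=
  GRing.isLinear.Build K (superspace K r) (superspace K r) _ (deriv_coord j)
    (deriv_coord_is_linear j).

Lemma contract_coord_is_linear j : linear (@contract_coord K r j).
Proof.
move=> c f g; apply/ffunP=> S; rewrite !ffunE; case: ifP => _.
  by rewrite scaler0 addr0.
by rewrite scalerDr !scalerA mulrC.
Qed.

HB.instance Definition _ j :=
  GRing.isLinear.Build K (superspace K r) (superspace K r) _ (contract_coord j)
    (contract_coord_is_linear j).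

Lemma wedge_coord_is_linear j : linear (wedge_coord j).
Proof.
move=> c f g; apply/ffunP=> S; rewrite !ffunE; case: ifP => _.
  by rewrite scalerDr !scalerA mulrC.
by rewrite scaler0 addr0.
Qed.

HB.instance Definition _ j :=
  GRing.isLinear.Build K (superspace K r) (superspace K r) _ (wedge_coord j)
    (wedge_coord_is_linear j).

Lemma pmul1 g : pmul 1 g = g.
Proof. by apply/ffunP=> S; rewrite !ffunE mul1r. Qed.

Lemma pmulA p q g : pmul p (pmul q g) = pmul (p * q) g.
Proof. by apply/ffunP=> S; rewrite !ffunE mulrA. Qed.

Lemma pmulDl p q g : pmul (p + q) g = pmul p g + pmul q g.
Proof. by apply/ffunP=> S; rewrite !ffunE mulrDl. Qed.

Lemma pmulZl c p g : pmul (c *: p) g = c *: pmul p g.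
Proof. by apply/ffunP=> S; rewrite !ffunE scalerAl. Qed.

Lemma pmul0l g : pmul 0 g = 0.
Proof. by apply/ffunP=> S; rewrite !ffunE mul0r. Qed.

Lemma pmulC c g : pmul c%:MP g = c *: g.
Proof. by apply/ffunP=> S; rewrite !ffunE mul_mpolyC. Qed.

Lemma pmul_suml (I : Type) (s : seq I) (P : pred I) (F : I -> {mpoly K[r]}) g :
  pmul (\sum_(i <- s | P i) F i) g = \sum_(i <- s | P i) pmul (F i) g.
Proof.
by elim/big_rec2: _ => [|i y x _ <-]; rewrite ?pmul0l // pmulDl.
Qed.

Lemma pmul_inj p : p != 0 -> injective (pmul p).
Proof.
move=> p0 f g /ffunP fg; apply/ffunP=> S; have := fg S; rewrite !ffunE.
exact: mulfI.
Qed.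

Lemma deriv_coordC j k g :
  deriv_coord j (deriv_coord k g) = deriv_coord k (deriv_coord j g).
Proof. by apply/ffunP=> S; rewrite !ffunE mderiv_comm. Qed.

Lemma deriv_coordM j p g :
  deriv_coord j (pmul p g) = pmul p^`M(j) g + pmul p (deriv_coord j g).
Proof. by apply/ffunP=> S; rewrite !ffunE mderivM. Qed.

Lemma deriv_contract_coord j k g :
  deriv_coord j (contract_coord k g) = contract_coord k (deriv_coord j g).
Proof. by apply/ffunP=> S; rewrite !ffunE; case: ifP; rewrite ?mderiv0 ?mderivZ. Qed.

Lemma deriv_wedge_coord j k g :
  deriv_coord j (wedge_coord k g) = wedge_coord k (deriv_coord j g).
Proof. by apply/ffunP=> S; rewrite !ffunE; case: ifP; rewrite ?mderiv0 ?mderivZ. Qed.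

Lemma contract_coordM j p g :
  contract_coord j (pmul p g) = pmul p (contract_coord j g).
Proof. by apply/ffunP=> S; rewrite !ffunE; case: ifP; rewrite ?mulr0 ?scalerAr. Qed.

Lemma wedge_coordM j p g :
  wedge_coord j (pmul p g) = pmul p (wedge_coord j g).
Proof. by apply/ffunP=> S; rewrite !ffunE; case: ifP; rewrite ?mulr0 ?scalerAr. Qed.

Lemma contract_coord2 j g : contract_coord j (contract_coord j g) = 0.
Proof.
by apply/ffunP=> S; rewrite !ffunE; case: ifP => // _; rewrite setU11 scaler0.
Qed.

Lemma wedge_coord2 j g : wedge_coord j (wedge_coord j g) = 0.
Proof.
by apply/ffunP=> S; rewrite !ffunE; case: ifP => // _; rewrite !inE eqxx scaler0.
Qed.

Lemma contract_coordC j k g : j != k ->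
  contract_coord j (contract_coord k g) = - contract_coord k (contract_coord j g).
Proof.
move=> njk; apply/ffunP=> S; rewrite !ffunE !inE eq_sym (negPf njk) /=.
have [jS|jS] := boolP (j \in S); have [kS|kS] := boolP (k \in S);
  rewrite /= ?scaler0 ?oppr0 //.
rewrite !scalerA !inversions_setU1 // !exprD (sign_ltn_swap _ njk) setUCA.
by rewrite -scaleNr; congr (_ *: _); ring.
Qed.

Lemma wedge_coordC j k g : j != k ->
  wedge_coord j (wedge_coord k g) = - wedge_coord k (wedge_coord j g).
Proof.
move=> njk; apply/ffunP=> S; rewrite !ffunE !inE (negPf njk) eq_sym (negPf njk) /=.
have [jS|jS] := boolP (j \in S); have [kS|kS] := boolP (k \in S);
  rewrite /= ?scaler0 ?oppr0 //.
have kSj : k \in S :\ j by rewrite !inE eq_sym njk.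
have jSk : j \in S :\ k by rewrite !inE njk.
rewrite !scalerA (inversions_setD1 j kSj) (inversions_setD1 k jSk) setD1C.
rewrite !exprD (sign_ltn_swap _ njk) -scaleNr; congr (_ *: _).
by ring.
Qed.

Lemma contract_wedge_coord j g :
  contract_coord j (wedge_coord j g) + wedge_coord j (contract_coord j g) = g.
Proof.
apply/ffunP=> S; rewrite !ffunE !inE eqxx /=.
have [jS|jS] := boolP (j \in S).
  by rewrite add0r scalerA -exprD addnn -signr_odd odd_double scale1r setD1K.
by rewrite addr0 setU1K // scalerA -exprD addnn -signr_odd odd_double scale1r.
Qed.

Lemma contract_wedge_coordC j k g : j != k ->
  contract_coord j (wedge_coord k g) = - wedge_coord k (contract_coord j g).
Proof.
move=> njk; apply/ffunP=> S; rewrite !ffunE !inE (negPf njk) eq_sym (negPf njk) /=.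
have [jS|jS] := boolP (j \in S); have [kS|kS] := boolP (k \in S);
  rewrite /= ?scaler0 ?oppr0 //.
have jSk : j \notin S :\ k by rewrite !inE (negPf jS) andbF.
rewrite setU1_setD1C // !scalerA (inversions_setD1 j kS) inversions_setU1 //.
rewrite !exprD (sign_ltn_swap _ njk) -scaleNr; congr (_ *: _).
by case: (k < j)%N; rewrite ?expr0 ?expr1; ring.
Qed.

End CoordinateOperators.

(** * Generators of superspace *)

Lemma setU1_ind (T : finType) (P : {set T} -> Prop) :
  P set0 -> (forall x (S : {set T}), x \notin S -> P S -> P (x |: S)) -> forall S, P S.
Proof.
move=> P0 PU S; have [n] := ubnP #|S|; elim: n S => // n IHn S.
have [->//|[x xS]] := set_0Vmem S; rewrite (cardsD1 x) xS => ltS.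
by rewrite -(setD1K xS); apply: PU; [rewrite !inE eqxx | apply: IHn].
Qed.

Section Generation.

Variables (K : fieldType) (r : nat).
Implicit Types (f g h : superspace K r) (j k : 'I_r) (S T : {set 'I_r}).

Lemma wedge_coord_delta j S p : j \notin S ->
  wedge_coord j [ffun T => if T == S then p else 0] =
  (-1) ^+ inversions [set j] S *: [ffun T => if T == j |: S then p else 0]
    :> superspace K r.
Proof.
move=> jS; apply/ffunP=> T; rewrite !ffunE; have [jT|jT] := boolP (j \in T).
  rewrite -[in RHS](setD1K jT) [T :\ j == S](_ : _ = (j |: T :\ j == j |: S)).
    case: eqP => [e|_]; last by rewrite !scaler0.
    by have -> : T :\ j = S by rewrite -(setU1K jS) -e setU1K // !inE eqxx.
  apply/eqP/eqP=> [-> //|e]; rewrite -(setU1K jS) -e setU1K // !inE eqxx //.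
by case: eqP => [e|_]; rewrite ?scaler0 //; rewrite e setU11 in jT.
Qed.

(** Coefficients are reached monomial by monomial, and t_S by wedging one index at a time.
    Identities between operators thus need checking only on 1 and against multiplication by x_j and
    t_j. *)
Lemma superspace_ind (P : superspace K r -> Prop) :
  (forall f g, P f -> P g -> P (f + g)) -> (forall c f, P f -> P (c *: f)) ->
  P (sup1 K r) -> (forall j f, P f -> P (pmul 'X_j f)) ->
  (forall j f, P f -> P (wedge_coord j f)) -> forall g, P g.
Proof.
move=> PD PZ P1 PX PW g.
have P0 : P 0 by rewrite -(scale0r (sup1 K r)); apply: PZ.
have PS (I : Type) (s : seq I) (Q : pred I) F :
  (forall i, Q i -> P (F i)) -> P (\sum_(i <- s | Q i) F i).
  by move=> PF; elim/big_ind: _.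
have PM p f : P f -> P (pmul p f).
  move=> Pf; rewrite [p]mpolyE pmul_suml; apply: PS => m _.
  rewrite pmulZl; apply: PZ; rewrite mpolyXE_id.
  pose Q (x : {mpoly K[r]}) := forall f, P f -> P (pmul x f).
  suff: Q (\prod_(i < r) 'X_i ^+ m i) by apply.
  elim/big_ind: _ => [h|x y Qx Qy h Ph|i _ h Ph]; first by rewrite pmul1.
    by rewrite -pmulA; apply/Qx/Qy.
  elim: (m i) => [|e IHe]; first by rewrite expr0 pmul1.
  by rewrite exprS -pmulA; apply: PX.
have PT S : P [ffun T => if T == S then 1 else 0].
  elim/setU1_ind: S => [|j S jS IHS] /=.
    suff -> : [ffun T => if T == set0 then 1 else 0] = sup1 K r by [].
    by apply/ffunP=> T; rewrite !ffunE.
  have := PZ ((-1) ^+ inversions [set j] S) _ (PW j _ IHS).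
  rewrite wedge_coord_delta // scalerA -exprD addnn -signr_odd odd_double.
  by rewrite scale1r.
suff -> : g = \sum_S pmul (g S) [ffun T => if T == S then 1 else 0].
  by apply: PS => S _; apply: PM.
apply/ffunP=> T; rewrite sum_ffunE (bigD1 T) //= !ffunE eqxx mulr1.
by rewrite big1 ?addr0 // => S nTS; rewrite !ffunE eq_sym (negPf nTS) mulr0.
Qed.

End Generation.

(** * Ordered products of anticommuting operators *)

Section SortedProducts.

Variables (r : nat) (K : fieldType) (V : lmodType K).
Variable a : 'I_r -> {linear V -> V}.
Implicit Types (j k : 'I_r) (S A B : {set 'I_r}) (x : V).
Hypothesis aC : forall j k x, j != k -> a j (a k x) = - a k (a j x).
Hypothesis a2 : forall j x, a j (a j x) = 0.

Lemma sorted_enum_set (S : {set 'I_r}) : sorted ltn (map val (enum S)).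
Proof.
rewrite /enum_mem; have: sorted ltn (map val (Finite.enum 'I_r)).
  by rewrite -enumT val_enum_ord iota_ltn_sorted.
rewrite !sorted_map; apply: sorted_filter.
by move=> x y z /=; apply: ltn_trans.
Qed.

(** A new operator enters at the left end of a product; moving it to its place in the increasing
    enumeration costs one sign per smaller index, which is what [inversions [set j] S] counts. *)
Definition insert_ord (j : 'I_r) := fix loop (s : seq 'I_r) : seq 'I_r :=
  if s is q :: s' then if (j < q)%N then j :: s else q :: loop s' else [:: j].

Lemma mem_insert_ord j s : insert_ord j s =i j :: s.
Proof.
elim: s => //= q s IHs x; case: ifP => // _.
by rewrite !inE IHs !inE orbCA.
Qed.

Lemma path_insert_ord (x j : 'I_r) s : path (relpre val ltn) x s -> (x < j)%N ->
  j \notin s -> path (relpre val ltn) x (insert_ord j s).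
Proof.
elim: s x => [|q s IHs] x /=; first by move=> _ ->.
move=> /andP[xq ps] xj; rewrite inE negb_or => /andP[njq js].
case: ifP => [jq|/negbT] /=; first by rewrite xj jq.
rewrite -leqNgt leq_eqVlt eq_sym val_eqE (negPf njq) /= => qj.
by rewrite xq IHs.
Qed.

Lemma enum_setU1 (j : 'I_r) (S : {set 'I_r}) : j \notin S ->
  enum (j |: S) = insert_ord j (enum S).
Proof.
move=> jS; apply: (inj_map val_inj).
apply: (irr_sorted_eq ltn_trans ltnn); first exact: sorted_enum_set.
  have := sorted_enum_set S; rewrite !sorted_map.
  have: j \notin enum S by rewrite mem_enum.
  case: (enum S) => //= q s; rewrite inE negb_or => /andP[njq js] ps.
  case: ifP => [jq|/negbT] /=; first by rewrite jq.
  rewrite -leqNgt leq_eqVlt eq_sym val_eqE (negPf njq) /= => qj.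
  exact: path_insert_ord.
move=> x; apply/mapP/mapP => -[y ys ->]; exists y => //; move: ys;
  by rewrite mem_insert_ord !(mem_enum, inE).
Qed.

Lemma foldr_insert_ord j s x : j \notin s -> path.sorted (relpre val ltn) s ->
  a j (foldr (fun k => a k) x s) =
  (-1) ^+ (\sum_(q <- s) (q < j))%N *: foldr (fun k => a k) x (insert_ord j s).
Proof.
elim: s => [|q s IHs] /=; first by rewrite big_nil scale1r.
rewrite inE negb_or => /andP[njq js] ps.
rewrite big_cons; case: ifP => [jq|/negbT] /=.
  rewrite ltnNge ltnW //= add0n.
  suff -> : (\sum_(q <- s) (q < j) = 0)%N by rewrite scale1r.
  rewrite big_seq big1 // => t ts.
  have /allP/(_ t ts) : all (fun t : 'I_r => (q < t)%N) s.
    by apply: order_path_min ps => x1 x2 x3 /=; apply: ltn_trans.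
  by move=> qt; rewrite ltnNge ltnW // (ltn_trans jq).
rewrite -leqNgt leq_eqVlt eq_sym val_eqE (negPf njq) /= => qj.
rewrite aC // IHs //; last exact: path_sorted ps.
by rewrite qj linearZ /= exprD expr1 mulN1r scaleNr.
Qed.

(** With contractions, this is how t_S acts in [odot]; with wedge products applied to 1, it is the
    pullback of t_S. *)
Definition sorted_prod (S : {set 'I_r}) (x : V) : V :=
  foldr (fun k => a k) x (enum S).

Lemma sorted_prod0 x : sorted_prod set0 x = x.
Proof. by rewrite /sorted_prod enum_set0. Qed.

Lemma sorted_prodU1 j S x : j \notin S ->
  a j (sorted_prod S x) = (-1) ^+ inversions [set j] S *: sorted_prod (j |: S) x.
Proof.
move=> jS; rewrite /sorted_prod foldr_insert_ord ?mem_enum //; last first.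
  by have := sorted_enum_set S; rewrite sorted_map.
rewrite enum_setU1 // inversions1E; congr (_ ^+ _ *: _).
by rewrite big_enum.
Qed.

Lemma sorted_prod_setU1 j S x : j \notin S ->
  sorted_prod (j |: S) x = (-1) ^+ inversions [set j] S *: a j (sorted_prod S x).
Proof. by move=> jS; rewrite sorted_prodU1 // scalerA -expr2 sqrr_sign scale1r. Qed.

Lemma sorted_prod_mem j S x : j \in S -> a j (sorted_prod S x) = 0.
Proof.
move=> jS; rewrite -(setD1K jS) sorted_prod_setU1 ?inE ?eqxx //.
by rewrite linearZ /= a2 scaler0.
Qed.

Lemma sorted_prod_is_linear S : linear (sorted_prod S).
Proof.
by rewrite /sorted_prod => c x y; elim: (enum S) => //= j s ->; rewrite linearP.
Qed.

HB.instance Definition _ S :=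
  GRing.isLinear.Build K V V _ (sorted_prod S) (sorted_prod_is_linear S).

Lemma sorted_prodM A B x :
  sorted_prod A (sorted_prod B x) =
  if [disjoint A & B] then (-1) ^+ inversions A B *: sorted_prod (A :|: B) x else 0.
Proof.
elim/setU1_ind: A => [|j A jA IHA] /=.
  by rewrite disjoints_subset sub0set sorted_prod0 set0U inversions0s scale1r.
rewrite sorted_prod_setU1 // {}IHA.
have -> : [disjoint j |: A & B] = (j \notin B) && [disjoint A & B].
  by rewrite !disjoints_subset subUset sub1set inE.
have [dAB|_] := boolP [disjoint A & B]; last by rewrite andbF linear0 scaler0.
rewrite andbT linearZ /=; case: ifP => [jB|/negbFE jB].
  rewrite sorted_prodU1 ?inE ?negb_or ?jA // setUA !scalerA inversions_setU1l //.
  rewrite -!exprD; congr (_ *: _).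
  suff -> : inversions [set j] (A :|: B) = (inversions [set j] A + inversions [set j] B)%N.
    rewrite -signr_odd -[RHS]signr_odd !oddD; congr (_ ^+ _).
    by case: (odd (inversions [set j] A)); case: (odd (inversions A B));
       case: (odd (inversions [set j] B)).
  by rewrite !inversions1E -bigU //; apply: eq_bigl => i; rewrite !inE.
by rewrite sorted_prod_mem ?inE ?jB ?orbT // !scaler0.
Qed.

End SortedProducts.

(** * Derivation and contraction by vectors, multiplication by forms *)

Section VectorOperators.

Variables (K : fieldType) (r : nat).
Implicit Types (f g h : superspace K r) (j k : 'I_r) (S T : {set 'I_r}).
Implicit Types (w u v : 'rV[K]_r) (c b : 'cV[K]_r) (p : {mpoly K[r]}).

(* Vectors are rows and linear forms are columns; [ev c w] is c(w). *)
Definition ev c w : K := (w *m c) 0 0.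

Definition linp c : {mpoly K[r]} := sym1 (fun j => c j 0).

Definition dird w g : superspace K r := \sum_j w 0 j *: deriv_coord j g.

Definition iprod w g : superspace K r := \sum_j w 0 j *: contract_coord j g.

Definition wedge c g : superspace K r := \sum_j c j 0 *: wedge_coord j g.

Lemma evE c w : ev c w = \sum_j w 0 j * c j 0.
Proof. by rewrite /ev mxE. Qed.

Lemma evDr c w u : ev c (w + u) = ev c w + ev c u.
Proof. by rewrite /ev mulmxDl mxE. Qed.

Lemma evBr c w u : ev c (w - u) = ev c w - ev c u.
Proof. by rewrite /ev mulmxBl !mxE. Qed.

Lemma evZr c a w : ev c (a *: w) = a * ev c w.
Proof. by rewrite /ev -scalemxAl mxE. Qed.

Lemma ev0r c : ev c 0 = 0.
Proof. by rewrite /ev mul0mx mxE. Qed.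

Lemma ev0l w : ev 0 w = 0.
Proof. by rewrite /ev mulmx0 mxE. Qed.

Lemma ev_eq0P c : (forall w, ev c w = 0) -> c = 0.
Proof.
move=> c0; apply/matrixP=> j o; rewrite !ord1 [RHS]mxE -(c0 (delta_mx 0 j)).
rewrite evE (bigD1 j) //= big1 ?addr0 => [|i nij]; rewrite mxE ?eqxx ?mul1r //.
by rewrite (negPf nij) mul0r.
Qed.

Lemma dird_is_linear w : linear (dird w).
Proof.
move=> c f g; rewrite /dird scaler_sumr -big_split /=; apply: eq_bigr => j _.
by rewrite linearP scalerDr !scalerA mulrC.
Qed.

HB.instance Definition _ w :=
  GRing.isLinear.Build K (superspace K r) (superspace K r) _ (dird w)
    (dird_is_linear w).

Lemma iprod_is_linear w : linear (iprod w).
Proof.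
move=> c f g; rewrite /iprod scaler_sumr -big_split /=; apply: eq_bigr => j _.
by rewrite linearP scalerDr !scalerA mulrC.
Qed.

HB.instance Definition _ w :=
  GRing.isLinear.Build K (superspace K r) (superspace K r) _ (iprod w)
    (iprod_is_linear w).

Lemma iprodD w f g : iprod w (f + g) = iprod w f + iprod w g.
Proof. exact: linearD. Qed.

Lemma iprodB w f g : iprod w (f - g) = iprod w f - iprod w g.
Proof. exact: linearB. Qed.

Lemma iprodN w f : iprod w (- f) = - iprod w f.
Proof. exact: linearN. Qed.

Lemma iprod0 w : iprod w 0 = 0.
Proof. exact: linear0. Qed.

Lemma wedge_is_linear c : linear (wedge c).
Proof.
move=> a f g; rewrite /wedge scaler_sumr -big_split /=; apply: eq_bigr => j _.
by rewrite linearP scalerDr !scalerA mulrC.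
Qed.

HB.instance Definition _ c :=
  GRing.isLinear.Build K (superspace K r) (superspace K r) _ (wedge c)
    (wedge_is_linear c).

Lemma wedgeD c f g : wedge c (f + g) = wedge c f + wedge c g.
Proof. exact: linearD. Qed.

Lemma wedgeB c f g : wedge c (f - g) = wedge c f - wedge c g.
Proof. exact: linearB. Qed.

Lemma dird0l g : dird 0 g = 0.
Proof. by rewrite /dird big1 // => j _; rewrite mxE scale0r. Qed.

Lemma iprodPl a w u g : iprod (a *: w + u) g = a *: iprod w g + iprod u g.
Proof.
rewrite /iprod scaler_sumr -big_split /=; apply: eq_bigr => j _.
by rewrite !mxE scalerDl scalerA.
Qed.

Lemma iprod0l g : iprod 0 g = 0.
Proof. by rewrite /iprod big1 // => j _; rewrite mxE scale0r. Qed.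

Lemma wedge0l g : wedge 0 g = 0.
Proof. by rewrite /wedge big1 // => j _; rewrite mxE scale0r. Qed.

Lemma dird_delta j g : dird (delta_mx 0 j) g = deriv_coord j g.
Proof.
rewrite /dird (bigD1 j) //= mxE !eqxx scale1r big1 ?addr0 // => i nij.
by rewrite mxE (negPf nij) andbF scale0r.
Qed.

Lemma iprod_delta j g : iprod (delta_mx 0 j) g = contract_coord j g.
Proof.
rewrite /iprod (bigD1 j) //= mxE !eqxx scale1r big1 ?addr0 // => i nij.
by rewrite mxE (negPf nij) andbF scale0r.
Qed.

Lemma wedge_delta j g : wedge (delta_mx j 0) g = wedge_coord j g.
Proof.
rewrite /wedge (bigD1 j) //= mxE !eqxx scale1r big1 ?addr0 // => i nij.
by rewrite mxE (negPf nij) scale0r.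
Qed.

Lemma linpPl a b c : linp (a *: b + c) = a *: linp b + linp c.
Proof.
rewrite /linp /sym1 scaler_sumr -big_split /=; apply: eq_bigr => i _.
by rewrite !mxE scalerDl scalerA.
Qed.

Lemma linp0 : linp 0 = 0.
Proof. by rewrite /linp /sym1 big1 // => j _; rewrite mxE scale0r. Qed.

Lemma linp_delta j : linp (delta_mx j 0) = 'X_j.
Proof.
rewrite /linp /sym1 (bigD1 j) //= mxE !eqxx scale1r big1 ?addr0 // => i nij.
by rewrite mxE (negPf nij) scale0r.
Qed.

Lemma linp_eq0 c : linp c = 0 -> c = 0.
Proof.
move=> c0; apply/matrixP=> j o; rewrite !ord1 [RHS]mxE.
have := congr1 (mcoeff U_(j)%MM) c0; rewrite mcoeff0 => <-.
rewrite /linp /sym1 raddf_sum (bigD1 j) //= mcoeffZ mcoeffXU eqxx mulr1.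
by rewrite big1 ?addr0 // => i nij; rewrite mcoeffZ mcoeffXU (negPf nij) mulr0.
Qed.

Lemma dirdC w u g : dird w (dird u g) = dird u (dird w g).
Proof.
rewrite /dird; under eq_bigr do rewrite linear_sum scaler_sumr.
rewrite exchange_big /=; apply: eq_bigr => j _; rewrite linear_sum scaler_sumr.
apply: eq_bigr => k _; rewrite !linearZ /= deriv_coordC !scalerA.
by rewrite mulrC.
Qed.

Lemma dird_iprod w u g : dird w (iprod u g) = iprod u (dird w g).
Proof.
rewrite /dird; under eq_bigr do rewrite linear_sum scaler_sumr.
rewrite exchange_big /=; apply: eq_bigr => j _; rewrite linear_sum scaler_sumr.
apply: eq_bigr => k _; rewrite !linearZ /= deriv_contract_coord !scalerA.
by rewrite mulrC.
Qed.

Lemma dird_wedge w c g : dird w (wedge c g) = wedge c (dird w g).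
Proof.
rewrite /dird; under eq_bigr do rewrite linear_sum scaler_sumr.
rewrite exchange_big /=; apply: eq_bigr => j _; rewrite linear_sum scaler_sumr.
apply: eq_bigr => k _; rewrite !linearZ /= deriv_wedge_coord !scalerA.
by rewrite mulrC.
Qed.

Lemma mderiv_linp j c : (linp c)^`M(j) = (c j 0)%:MP.
Proof.
rewrite /linp /sym1 raddf_sum (bigD1 j) //= big1 => [|i nij] /=.
  rewrite addr0 mderivZ mderivX mnm1E eqxx.
  have -> : (U_(j) - U_(j))%MM = 0%MM :> 'X_{1..r}.
    by apply/mnmP=> i; rewrite mnmBE subnn mnm0E.
  by rewrite mpolyX0 scale1r -mul_mpolyC mulr1.
by rewrite mderivZ mderivX mnm1E (negPf nij) scale0r scaler0.
Qed.

Lemma dird_linp w c g :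
  dird w (pmul (linp c) g) = pmul (linp c) (dird w g) + ev c w *: g.
Proof.
rewrite /dird linear_sum evE scaler_suml -big_split /=; apply: eq_bigr => j _.
rewrite deriv_coordM mderiv_linp pmulC scalerDr scalerA addrC.
by congr (_ + _); rewrite linearZ.
Qed.

Lemma iprodM w p g : iprod w (pmul p g) = pmul p (iprod w g).
Proof.
rewrite /iprod linear_sum; apply: eq_bigr => j _.
by rewrite contract_coordM linearZ.
Qed.

Lemma wedgeM c p g : wedge c (pmul p g) = pmul p (wedge c g).
Proof.
rewrite /wedge linear_sum; apply: eq_bigr => j _.
by rewrite wedge_coordM linearZ.
Qed.

Lemma iprod_wedge_coord w j g :
  iprod w (wedge_coord j g) = w 0 j *: g - wedge_coord j (iprod w g).
Proof.
rewrite /iprod linear_sum (bigD1 j) //= [in RHS](bigD1 j) //= opprD addrA -sumrN.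
congr (_ + _).
  by rewrite linearZ /= -scalerBr; congr (_ *: _); rewrite -{2}[g](contract_wedge_coord j) addrK.
apply: eq_bigr => i nij.
by rewrite contract_wedge_coordC // scalerN; congr (- _); rewrite linearZ.
Qed.

Lemma iprod_wedge w c g : iprod w (wedge c g) = ev c w *: g - wedge c (iprod w g).
Proof.
rewrite /wedge linear_sum evE scaler_suml -sumrB; apply: eq_bigr => j _.
by rewrite linearZ /= iprod_wedge_coord scalerBr scalerA mulrC.
Qed.

Lemma dird_sup1 w : dird w (sup1 K r) = 0.
Proof.
rewrite /dird big1 // => j _; apply/ffunP=> S; rewrite !ffunE.
by case: ifP => _; rewrite -?mpolyC1 ?mderivC ?mderiv0 scaler0.
Qed.

Lemma iprod_sup1 w : iprod w (sup1 K r) = 0.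
Proof.
rewrite /iprod big1 // => j _; apply/ffunP=> S; rewrite !ffunE.
case: ifP => _; first by rewrite scaler0.
by rewrite (negPf (_ : j |: S != set0)) ?scaler0 //; apply/set0Pn; exists j; rewrite setU11.
Qed.

Lemma iprod2 w g : iprod w (iprod w g) = 0.
Proof.
elim/superspace_ind: g => [f g|c f||j f IH|j f IH].
- by rewrite !linearD /= => -> ->; rewrite addr0.
- by rewrite !linearZ /= => ->; rewrite scaler0.
- by rewrite iprod_sup1 linear0.
- by rewrite !iprodM IH linear0.
- rewrite iprod_wedge_coord linearB /= linearZ /= iprod_wedge_coord IH linear0.
  by rewrite subr0 subrr.
Qed.

Lemma iprodDl w u g : iprod (w + u) g = iprod w g + iprod u g.
Proof. by rewrite -[w]scale1r iprodPl !scale1r. Qed.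

Lemma iprodC w u g : iprod w (iprod u g) = - iprod u (iprod w g).
Proof.
have := iprod2 (w + u) g; rewrite !iprodDl !iprodD !iprod2 add0r addr0 => /eqP.
by rewrite addr_eq0 => /eqP.
Qed.

End VectorOperators.

(** * Degree of a form along a vector *)

Section Degree.

Variables (K : fieldType) (r : nat).
Hypothesis K0 : [pchar K] =i pred0.
Implicit Types (f g h : superspace K r) (j k : 'I_r) (S T : {set 'I_r}).
Implicit Types (w u v : 'rV[K]_r) (c b : 'cV[K]_r) (p : {mpoly K[r]}).

Lemma natf_neq0 n : (n.+1%:R != 0 :> K).
Proof. by move/pcharf0P: K0 => ->. Qed.

Lemma wedge2 c g : wedge c (wedge c g) = 0.
Proof.
set T := wedge c _; suff TN : T = - T.
  have: 2%:R *: T = 0 by rewrite scaler_nat mulr2n {2}TN subrr.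
  by move/eqP; rewrite scaler_eq0 (negPf (natf_neq0 1)) => /eqP.
rewrite {}/T /wedge; under eq_bigr do rewrite linear_sum scaler_sumr.
rewrite -sumrN [LHS]exchange_big /=; apply: eq_bigr => i _.
rewrite -sumrN; apply: eq_bigr => j _.
rewrite !linearZ /= !scalerA; have [->|nij] := eqVneq i j.
  by rewrite wedge_coord2 oppr0.
by rewrite wedge_coordC // eq_sym.
Qed.

Lemma wedgePl a c b g : wedge (a *: c + b) g = a *: wedge c g + wedge b g.
Proof.
rewrite /wedge scaler_sumr -big_split /=; apply: eq_bigr => j _.
by rewrite !mxE scalerDl scalerA.
Qed.

Lemma wedgeDl c b g : wedge (c + b) g = wedge c g + wedge b g.
Proof. by rewrite -[c]scale1r wedgePl !scale1r. Qed.

Lemma wedgeC c b g : wedge c (wedge b g) = - wedge b (wedge c g).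
Proof.
have := wedge2 (c + b) g; rewrite !wedgeDl !wedgeD !wedge2 add0r addr0 => /eqP.
by rewrite addr_eq0 => /eqP.
Qed.

Lemma iter_dird_is_linear n w : linear (iter n (dird w)).
Proof. by move=> c f g; elim: n => //= n ->; rewrite linearP. Qed.

HB.instance Definition _ n w :=
  GRing.isLinear.Build K (superspace K r) (superspace K r) _ (iter n (dird w))
    (iter_dird_is_linear n w).

Lemma iter_commute n w (F : superspace K r -> superspace K r) g :
  (forall g, dird w (F g) = F (dird w g)) ->
  iter n (dird w) (F g) = F (iter n (dird w) g).
Proof. by move=> wF; elim: n => //= n ->. Qed.

Lemma iter_dird_linp n w c g :
  iter n (dird w) (pmul (linp c) g) =
  pmul (linp c) (iter n (dird w) g) + (n%:R * ev c w) *: iter n.-1 (dird w) g.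
Proof.
elim: n => [|n IHn]; first by rewrite mul0r scale0r addr0.
rewrite iterS IHn linearD linearZ /= dird_linp -addrA; congr (_ + _).
case: n {IHn} => [|n] /=; first by rewrite mul0r scale0r addr0 mul1r.
by rewrite -scalerDl [in RHS]mulrS mulrDl mul1r.
Qed.

Lemma dird_nilp w g : exists n, iter n (dird w) g = 0.
Proof.
elim/superspace_ind: g => [f g [m fm] [n gn]|c f [n fn]||j f [n fn]|j f [n fn]].
- exists (m + n)%N; rewrite linearD /= {1}addnC !iterD fm gn.
  by rewrite !linear0 addr0.
- by exists n; rewrite linearZ /= fn scaler0.
- by exists 1; rewrite /= dird_sup1.
- by exists n.+1; rewrite -linp_delta iter_dird_linp /= fn !linear0 add0r.
- by exists n; rewrite -wedge_delta iter_commute ?fn ?linear0 // => h; rewrite dird_wedge.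
Qed.

(* If m is maximal with D_w^m y <> 0, then applying D_w^m to the equation leaves
   (m + n) c(w) D_w^m y = 0. *)
Lemma linp_ode n w c y : (0 < n)%N -> ev c w != 0 ->
  pmul (linp c) (dird w y) + (n%:R * ev c w) *: y = 0 -> y = 0.
Proof.
move=> n_gt0 cw eqy; have [m ym] := dird_nilp w y.
have exm : exists m, iter m (dird w) y == 0 by exists m; apply/eqP.
case: (ex_minnP exm) => {m ym exm} -[|m] /eqP ym minm; first by [].
have := congr1 (iter m (dird w)) eqy.
rewrite linearD linear0 linearZ /= iter_dird_linp -iterSr ym linear0 add0r.
have -> : (m%:R * ev c w) *: iter m.-1 (dird w) (dird w y) =
          (m%:R * ev c w) *: iter m (dird w) y.
  by case: m {ym minm} => [|m]; rewrite ?mul0r ?scale0r // -iterSr.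
rewrite -scalerDl -mulrDl -natrD => /eqP; rewrite scaler_eq0 mulf_eq0 (negPf cw).
move/pcharf0P: K0 => ->; rewrite addn_eq0 [n == _]eqn0Ngt n_gt0 andbF /=.
by move=> /minm; rewrite ltnn.
Qed.

(* g has degree less than n along w, the differential along w counting for one;
   [deg_lt w 0 g] means [g = 0]. *)
Definition deg_lt w n g :=
  iter n (dird w) g = 0 /\ iter n.-1 (dird w) (iprod w g) = 0.

Lemma deg_lt0P w g : deg_lt w 0 g <-> g = 0.
Proof. by split=> [[]//|->]; split; rewrite /= ?linear0. Qed.

Lemma deg_lt_0 w n : deg_lt w n 0.
Proof. by split; rewrite !linear0. Qed.

Lemma deg_ltD w n f g : deg_lt w n f -> deg_lt w n g -> deg_lt w n (f + g).
Proof. by case=> f1 f2 [g1 g2]; split; rewrite !linearD /= ?f1 ?g1 ?f2 ?g2 addr0. Qed.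

Lemma deg_ltZ w n a g : deg_lt w n g -> deg_lt w n (a *: g).
Proof. by case=> g1 g2; split; rewrite !linearZ /= ?g1 ?g2 scaler0. Qed.

Lemma deg_ltN w n g : deg_lt w n g -> deg_lt w n (- g).
Proof. by rewrite -scaleN1r; apply: deg_ltZ. Qed.

Lemma deg_ltB w n f g : deg_lt w n f -> deg_lt w n g -> deg_lt w n (f - g).
Proof. by move=> fn gn; apply: deg_ltD => //; apply: deg_ltN. Qed.

Lemma deg_ltW w m n g : (m <= n)%N -> deg_lt w m g -> deg_lt w n g.
Proof.
case: m => [_ /deg_lt0P->|m lemn [g1 g2]]; first exact: deg_lt_0.
case: n lemn => // n lemn; split.
  by rewrite -(subnK lemn) iterD g1 linear0.
by rewrite /= -(subnK (lemn : (m <= n)%N)) iterD g2 linear0.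
Qed.

Lemma deg_lt_null n g : deg_lt 0 n.+1 g.
Proof. by split; rewrite ?iprod0l ?linear0 //= dird0l. Qed.

Lemma deg_lt_dird w u n g : deg_lt w n g -> deg_lt w n (dird u g).
Proof.
have C m h : iter m (dird w) (dird u h) = dird u (iter m (dird w) h).
  by apply: iter_commute => h'; rewrite dirdC.
by case=> g1 g2; split; rewrite -?dird_iprod C ?g1 ?g2 linear0.
Qed.

Lemma deg_lt_iprod w u n g : deg_lt w n g -> deg_lt w n (iprod u g).
Proof.
have C m h : iter m (dird w) (iprod u h) = iprod u (iter m (dird w) h).
  by apply: iter_commute => h'; rewrite dird_iprod.
by case=> g1 g2; split; rewrite 1?iprodC 1?linearN /= C ?g1 ?g2 linear0 ?oppr0.
Qed.

Lemma deg_lt_linp w n c g : deg_lt w n g ->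
  deg_lt w ((ev c w != 0)%R + n)%N (pmul (linp c) g).
Proof.
case=> g1 g2; rewrite /deg_lt iprodM !iter_dird_linp.
case: eqP => [->|_] /=; last first.
  rewrite add1n /= g1 !linear0 addr0; split=> //.
  case: n g1 g2 => [/= g0|n] _; first by rewrite g0 !linear0 addr0.
  by rewrite /= => ->; rewrite !linear0 addr0.
by rewrite add0n !mulr0 !scale0r g1 g2 !linear0 addr0.
Qed.

Lemma deg_lt_wedge w n c g : deg_lt w n g ->
  deg_lt w ((ev c w != 0)%R + n)%N (wedge c g).
Proof.
have C m h : iter m (dird w) (wedge c h) = wedge c (iter m (dird w) h).
  by apply: iter_commute => h'; rewrite dird_wedge.
case=> g1 g2; rewrite /deg_lt iprod_wedge linearB linearZ /= !C.
case: eqP => [->|_] /=; last first.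
  rewrite add0n g1 !linear0 ?scaler0 sub0r; split=> //.
  case: n g1 g2 => [/= g0|n] _ /=; first by rewrite g0 !linear0.
  by move=> g2; rewrite g2 !linear0.
by rewrite add0n scale0r g1 g2 !linear0 ?subr0 ?addr0.
Qed.

(** If c(w) <> 0, the Leibniz rule turns D_w^(n+1) (c g) = 0 into c D_w y + (n + 1) c(w) y = 0 for y
    = D_w^n g, whose only solution is 0. The contraction of g satisfies the same equation one order
    lower. *)
Lemma deg_lt_linp_inv w n c g : c != 0 ->
  deg_lt w ((ev c w != 0)%R + n)%N (pmul (linp c) g) -> deg_lt w n g.
Proof.
move=> c0; have lc0 : linp c != 0 by apply: contra_neq c0 => /linp_eq0.
have inj0 h : pmul (linp c) h = 0 -> h = 0.
  by move=> h0; apply: (pmul_inj lc0); rewrite h0 linear0.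
rewrite /deg_lt iprodM !iter_dird_linp; case: eqVneq => [->|cw] /=.
  by rewrite add0n !mulr0 !scale0r !addr0 => -[/inj0-> /inj0->].
rewrite add1n /= => -[g1 g2].
have gn : iter n (dird w) g = 0 by apply: linp_ode g1.
split=> //; case: n gn g2 {g1} => [/= -> _|n _ g2]; first by rewrite linear0.
exact: linp_ode g2.
Qed.

Lemma constant_form g : (forall w, deg_lt w 1 g) -> exists a, g = a *: sup1 K r.
Proof.
move=> gw; have g1 j : deriv_coord j g = 0 by rewrite -dird_delta; case: (gw (delta_mx 0 j)).
have g2 j : contract_coord j g = 0 by rewrite -iprod_delta; case: (gw (delta_mx 0 j)).
exists (g set0)@_0; apply/ffunP=> S; rewrite !ffunE; case: eqP => [->|/eqP/set0Pn[j jS]].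
  apply/mpolyP=> m; rewrite mcoeffZ mcoeff1; have [->|m0] := eqVneq; first by rewrite mulr1.
  have [j mj] : exists j, m j != 0.
    apply/existsP; rewrite -negb_forall; apply: contra_neqN m0 => /forallP m0.
    by apply/mnmP=> j; rewrite mnm0E; apply/eqP.
  have mE : m = (m - U_(j) + U_(j))%MM.
    by rewrite submK //; apply/mnm_lepP=> i; rewrite mnm1E; case: eqP => // <-; rewrite lt0n.
  have := congr1 (mcoeff (m - U_(j))%MM) (congr1 (fun h : superspace K r => h set0) (g1 j)).
  rewrite !ffunE mcoeff0 mcoeff_deriv -mE => /eqP.
  by rewrite -[_ *+ _.+1]mulr_natl mulf_eq0 (negPf (natf_neq0 _)) mulr0 => /eqP.
have := congr1 (fun h : superspace K r => h (S :\ j)) (g2 j).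
rewrite !ffunE !inE eqxx /= setD1K // scaler0 => /eqP.
by rewrite scaler_eq0 signr_eq0 => /eqP.
Qed.

End Degree.

(** * Inverse systems of differential closures *)

Section DifferentialClosure.

Variables (K : fieldType) (r : nat).
Implicit Types (f g h : superspace K r) (j k : 'I_r) (S T A B : {set 'I_r}).
Implicit Types (w u v : 'rV[K]_r) (p q : {mpoly K[r]}).

Lemma diff_opwE n p q : (msize p <= n)%N ->
  diff_op p q = \sum_(m : 'X_{1..r < n}) p@_m *: q^`M[m].
Proof.
move=> le_pn; pose I : subFinType _ := 'X_{1..r < n}.
rewrite /diff_op (ssrcomplements.big_mksub I) //=; first last.
  by move=> x /msize_mdeg_lt /leq_trans; apply.
  by rewrite msupp_uniq.
rewrite big_rmcond //= => i; rewrite -mcoeff_eq0 => /eqP ->.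
by rewrite scale0r.
Qed.

Lemma diff_op_is_linear p : linear (diff_op p).
Proof.
move=> a q q'; rewrite /diff_op scaler_sumr -big_split /=; apply: eq_bigr => m _.
by rewrite linearP scalerDr !scalerA mulrC.
Qed.

HB.instance Definition _ p :=
  GRing.isLinear.Build K {mpoly K[r]} {mpoly K[r]} _ (diff_op p)
    (diff_op_is_linear p).

Lemma diff_opPl a p p' q : diff_op (a *: p + p') q = a *: diff_op p q + diff_op p' q.
Proof.
pose n := maxn (msize p) (maxn (msize p') (msize (a *: p + p'))).
rewrite !(@diff_opwE n) ?leq_max ?leqnn ?orbT // scaler_sumr -big_split /=.
by apply: eq_bigr => m _; rewrite mcoeffD mcoeffZ scalerDl scalerA.
Qed.

Lemma diff_op0l q : diff_op 0 q = 0.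
Proof. by rewrite /diff_op msupp0 big_nil. Qed.

Lemma diff_opX m q : diff_op 'X_[m] q = q^`M[m].
Proof. by rewrite /diff_op msuppX big_seq1 mcoeffX eqxx scale1r. Qed.

Lemma diff_opM p p' q : diff_op (p * p') q = diff_op p (diff_op p' q).
Proof.
elim/mpolyind: p => [|a m p _ _ IHp]; first by rewrite mul0r !diff_op0l.
rewrite mulrDl -scalerAl !diff_opPl {}IHp; congr (_ *: _ + _).
rewrite diff_opX; elim/mpolyind: p' => [|b m' p' _ _ IHp].
  by rewrite mulr0 !diff_op0l linear0.
rewrite mulrDr -scalerAr !diff_opPl {}IHp linearP /=; congr (_ *: _ + _).
by rewrite -mpolyXD !diff_opX -mderivmDm addmC.
Qed.

Definition dop p g : superspace K r := [ffun S => diff_op p (g S)].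

Lemma dop_is_linear p : linear (dop p).
Proof. by move=> a f g; apply/ffunP=> S; rewrite !ffunE linearP. Qed.

HB.instance Definition _ p :=
  GRing.isLinear.Build K (superspace K r) (superspace K r) _ (dop p)
    (dop_is_linear p).

Lemma dopPl a p q g : dop (a *: p + q) g = a *: dop p g + dop q g.
Proof. by apply/ffunP=> S; rewrite !ffunE diff_opPl. Qed.

Lemma dop0l g : dop 0 g = 0.
Proof. by apply/ffunP=> S; rewrite !ffunE diff_op0l. Qed.

Lemma dop_suml (I : Type) (s : seq I) (P : pred I) (F : I -> {mpoly K[r]}) g :
  dop (\sum_(i <- s | P i) F i) g = \sum_(i <- s | P i) dop (F i) g.
Proof.
elim/big_rec2: _ => [|i y x _ <-]; first exact: dop0l.
by rewrite -[F i]scale1r dopPl !scale1r.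
Qed.

Lemma dopZl a p g : dop (a *: p) g = a *: dop p g.
Proof. by rewrite -[a *: p]addr0 dopPl dop0l addr0. Qed.

Lemma dop1 g : dop 1 g = g.
Proof. by apply/ffunP=> S; rewrite !ffunE -mpolyX0 diff_opX mderivm0m. Qed.

Lemma dopM p q g : dop (p * q) g = dop p (dop q g).
Proof. by apply/ffunP=> S; rewrite !ffunE diff_opM. Qed.

Lemma dopX j g : dop 'X_j g = deriv_coord j g.
Proof. by apply/ffunP=> S; rewrite !ffunE diff_opX mderivmU1m. Qed.

Lemma dop_contract_coord p j g :
  dop p (contract_coord j g) = contract_coord j (dop p g).
Proof. by apply/ffunP=> S; rewrite !ffunE; case: ifP; rewrite ?linear0 ?linearZ. Qed.

Lemma dop_ind (P : {mpoly K[r]} -> Prop) : P 0 -> P 1 ->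
  (forall a p q, P p -> P q -> P (a *: p + q)) ->
  (forall j p, P p -> P ('X_j * p)) -> forall p, P p.
Proof.
move=> P0 P1 PP PX; apply: mpolyind => // a m p _ _ Pp; apply: PP => //.
rewrite mpolyXE_id; pose Q x := forall q : {mpoly K[r]}, P q -> P (x * q).
rewrite -[X in P X]mulr1; suff: Q (\prod_(i < r) 'X_i ^+ m i) by apply.
elim/big_ind: _ => [q|x y Qx Qy q Pq|i _ q Pq]; rewrite ?mul1r //.
  by rewrite -mulrA; apply/Qx/Qy.
by elim: (m i) => [|e IHe]; rewrite ?expr0 ?mul1r // exprS -mulrA; apply: PX.
Qed.

(** The commutator of p(d/dx) with x_j in the Weyl algebra is the partial derivative of p evaluated
    at d/dx. *)
Lemma dop_mulX p j g :
  dop p (pmul 'X_j g) = pmul 'X_j (dop p g) + dop p^`M(j) g.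
Proof.
elim/dop_ind: p => [||a p q IHp IHq|k p IHp].
- by rewrite mderiv0 !dop0l pmul0 addr0.
- by rewrite -{2}mpolyC1 mderivC dop0l !dop1 addr0.
- rewrite mderivD mderivZ !dopPl IHp IHq pmulD linearZ /= scalerDr.
  exact: addrACA.
- rewrite !dopM !dopX IHp mderivM linearD /= deriv_coordM.
  have -> : 'X_k^`M(j) = ('X_j : {mpoly K[r]})^`M(k).
    rewrite !mderivX !mnm1E eq_sym; case: eqP => [->//|_]; by rewrite !scale0r.
  rewrite -[_ + 'X_k * _]scale1r -[1 *: _]addr0 dopPl dop0l addr0 scale1r.
  rewrite -[_ * p]scale1r dopPl scale1r dopM [dop ('X_k * _) g]dopM dopX.
  rewrite -addrA [RHS]addrCA.
  suff -> : dop ('X_j)^`M(k) (dop p g) = pmul ('X_j)^`M(k) (dop p g).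
    by [].
  rewrite mderivX mnm1E; case: eqP => [->|_]; last by rewrite !scale0r dop0l pmul0l.
  have -> : (U_(k) - U_(k))%MM = 0%MM :> 'X_{1..r}.
    by apply/mnmP=> i; rewrite mnmBE subnn mnm0E.
  by rewrite scale1r mpolyX0 dop1 pmul1.
Qed.

Definition contract_lin j : {linear superspace K r -> superspace K r} :=
  @contract_coord K r j.

Lemma contract_linC j k g : j != k ->
  contract_lin j (contract_lin k g) = - contract_lin k (contract_lin j g).
Proof. exact: contract_coordC. Qed.

Lemma contract_lin2 j g : contract_lin j (contract_lin j g) = 0.
Proof. exact: contract_coord2. Qed.

Lemma odotE f g : odot f g = \sum_S dop (f S) (sorted_prod contract_lin S g).
Proof. by apply/ffunP=> T; rewrite ffunE sum_ffunE; apply: eq_bigr => S _; rewrite ffunE. Qed.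

Lemma odot_is_linear f : linear (odot f).
Proof.
move=> a g h; rewrite !odotE scaler_sumr -big_split /=; apply: eq_bigr => S _.
by rewrite !linearP.
Qed.

HB.instance Definition _ f :=
  GRing.isLinear.Build K (superspace K r) (superspace K r) _ (odot f)
    (odot_is_linear f).

Lemma odotDl f h g : odot (f + h) g = odot f g + odot h g.
Proof.
rewrite !odotE -big_split; apply: eq_bigr => S _ /=.
by rewrite ffunE -[f S]scale1r dopPl !scale1r.
Qed.

Lemma odot0l g : odot 0 g = 0.
Proof. by rewrite odotE big1 // => S _; rewrite ffunE dop0l. Qed.

Lemma odot_sym p g : odot (sup_sym p) g = dop p g.
Proof.
rewrite odotE (bigD1 set0) //= ffunE eqxx sorted_prod0 big1 ?addr0 // => S nS.
by rewrite ffunE (negPf nS) dop0l.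
Qed.

Lemma dop_sorted_prod p S g :
  dop p (sorted_prod contract_lin S g) = sorted_prod contract_lin S (dop p g).
Proof.
rewrite /sorted_prod; elim: (enum S) => //= j s IHs.
by rewrite [LHS]dop_contract_coord IHs.
Qed.

(** Constant-coefficient operators commute with contractions, and ordered products of contractions
    multiply with the signs of [sup_mul]. The sum over A inside S becomes a sum over disjoint pairs
    A, B with union S. *)
Lemma odot_mul f h g : odot (sup_mul f h) g = odot f (odot h g).
Proof.
rewrite [RHS]odotE odotE.
under eq_bigr do rewrite ffunE dop_suml.
under eq_bigr do under eq_bigl do rewrite powersetE.
rewrite (exchange_big_dep xpredT) //=; apply: eq_bigr => A _.
rewrite odotE !linear_sum /= [RHS](bigID (fun B => [disjoint A & B])) /=.
rewrite [X in _ = _ + X]big1 => [|B /negPf dAB]; last first.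
  by rewrite -dop_sorted_prod (sorted_prodM contract_linC contract_lin2) dAB !linear0.
rewrite addr0 (reindex_onto (fun B => A :|: B) (fun S => S :\: A)) /=; last first.
  move=> S /subsetP AS; apply/setP=> x; rewrite !inE.
  by case: (boolP (x \in A)) => [/AS ->|].
have dABE B : ((A :|: B) :\: A == B) = [disjoint A & B].
  rewrite disjoint_sym -setI_eq0; apply/eqP/eqP=> [<-|BA]; apply/setP=> x.
    by rewrite !inE; case: (x \in A); rewrite ?andbF.
  by move/setP/(_ x): BA; rewrite !inE; case: (x \in A); case: (x \in B).
apply: eq_big => [B|B /andP[_ /eqP eB]]; first by rewrite subsetUl dABE.
have dAB : [disjoint A & B] by rewrite -dABE eB.
rewrite eB dopZl dopM -!dop_sorted_prod.
by rewrite (sorted_prodM contract_linC contract_lin2) dAB !linearZ.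
Qed.

(** Contraction by the Euler vector field, the sum of the x_j d/dx_j. *)
Definition euler g := \sum_j pmul 'X_j (contract_coord j g).

(** Conjugation by this sign negates operators of odd degree, so the supercommutator with [euler]
    can be written without splitting the other operator by degree. *)
Definition parity g : superspace K r := [ffun S : {set 'I_r} => (-1) ^+ #|S| *: g S].

Lemma euler_is_linear : linear euler.
Proof.
move=> a f g; rewrite /euler scaler_sumr -big_split /=; apply: eq_bigr => j _.
by rewrite !linearP.
Qed.

HB.instance Definition _ :=
  GRing.isLinear.Build K (superspace K r) (superspace K r) _ euler
    euler_is_linear.

Lemma parity_is_linear : linear parity.
Proof.
move=> a f g; apply/ffunP=> S; rewrite !ffunE scalerDr !scalerA.
by rewrite mulrC.
Qed.

HB.instance Definition _ :=
  GRing.isLinear.Build K (superspace K r) (superspace K r) _ parity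
    parity_is_linear.

Lemma parityK g : parity (parity g) = g.
Proof. by apply/ffunP=> S; rewrite !ffunE scalerA -expr2 sqrr_sign scale1r. Qed.

Lemma parity_contract_coord j g :
  parity (contract_coord j g) = - contract_coord j (parity g).
Proof.
apply/ffunP=> S; rewrite !ffunE; case: ifP => [_|/negbT jS]; first by rewrite scaler0 oppr0.
rewrite cardsU1 jS exprD expr1 mulN1r !scaleNr scalerN opprK !scalerA.
by rewrite mulrC.
Qed.

Lemma parity_dop p g : parity (dop p g) = dop p (parity g).
Proof. by apply/ffunP=> S; rewrite !ffunE linearZ. Qed.

Lemma euler_contract_coord k g :
  euler (contract_coord k g) = - contract_coord k (euler g).
Proof.
rewrite /euler linear_sum -sumrN; apply: eq_bigr => j _ /=.
rewrite contract_coordM -linearN; have [->|njk] := eqVneq j k.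
  by rewrite contract_coord2 oppr0.
by rewrite contract_coordC.
Qed.

Lemma euler_sorted_prod S g :
  euler (sorted_prod contract_lin S g) =
  parity (sorted_prod contract_lin S (parity (euler g))).
Proof.
rewrite /sorted_prod; elim: (enum S) => [|j s IHs] /=; first by rewrite parityK.
by rewrite [LHS]euler_contract_coord IHs [RHS]parity_contract_coord.
Qed.

(* The derivation d of Psi_L corresponds to the supercommutator with the
   contraction by the Euler vector field. *)
Lemma odot_d f g :
  odot (sup_d f) g = parity (odot f (parity (euler g))) - euler (odot f g).
Proof.
rewrite !odotE [parity _]linear_sum [euler (\sum_S _)]linear_sum -sumrB /=.
(* Terms with j in S vanish on both sides; for the others, the commutator of p(d/dx) with x_j
   produces the derivative of p. *)
transitivity (\sum_(S : {set 'I_r}) \sum_(j | j \notin S)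
    dop (f S)^`M(j) (contract_coord j (sorted_prod contract_lin S g))).
  under eq_bigr do rewrite ffunE dop_suml.
  rewrite (exchange_big_dep xpredT) //= [RHS](exchange_big_dep xpredT) //=.
  apply: eq_bigr => j _.
  rewrite (reindex_onto (fun S => j |: S) (fun S => S :\ j)) /=; last first.
    by move=> S jS; rewrite setD1K.
  apply: eq_big => [S|S].
    rewrite setU11 /=; apply/eqP/idP => [<-|jS]; first by rewrite !inE eqxx.
    by rewrite setU1K.
  case/andP=> jS1 /eqP jS2; have jS : j \notin S by rewrite -jS2 !inE eqxx.
  rewrite jS2 dopZl -[contract_coord j _]/(contract_lin j _).
  by rewrite (sorted_prodU1 contract_linC) // linearZ.
apply: eq_bigr => S _.
rewrite parity_dop -euler_sorted_prod /euler [dop _ (\sum_j _)]linear_sum -sumrB /=.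
rewrite [RHS](bigID (fun j => j \in S)) /=.
rewrite [X in _ = X + _]big1 => [|j jS]; last first.
  rewrite -dop_contract_coord -[contract_coord j _]/(contract_lin j _).
  by rewrite (sorted_prod_mem contract_linC contract_lin2) // !linear0 ?subr0 ?addr0.
rewrite add0r; apply: eq_bigr => j jS.
by rewrite dop_mulX !dop_contract_coord [X in X - _]addrC addrK.
Qed.

End DifferentialClosure.

(** * Ideals generated by powers of vectors *)

Section InverseSystem.

Variables (K : fieldType) (r : nat).
Hypothesis K0 : [pchar K] =i pred0.
Implicit Types (f g h : superspace K r) (j k : 'I_r) (S T A B : {set 'I_r}).
Implicit Types (w u v : 'rV[K]_r) (p q : {mpoly K[r]}).

Lemma ev_delta j w : ev (delta_mx j 0) w = w 0 j.
Proof.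
rewrite evE (bigD1 j) //= mxE !eqxx mulr1 big1 ?addr0 // => i nij.
by rewrite mxE (negPf nij) mulr0.
Qed.

Lemma dop_sym1 (c : 'I_r -> K) n g :
  dop (sym1 c ^+ n) g = iter n (dird (\row_j c j)) g.
Proof.
elim: n => [|n IHn]; first by rewrite expr0 dop1.
rewrite exprS dopM IHn /= /sym1 dop_suml; apply: eq_bigr => j _.
by rewrite dopZl dopX mxE.
Qed.

Lemma dird_euler w g : dird w (euler g) = euler (dird w g) + iprod w g.
Proof.
rewrite {1}/euler linear_sum [euler _]/euler /iprod -big_split /=.
apply: eq_bigr => j _; rewrite -linp_delta dird_linp ev_delta.
by rewrite -!iprod_delta dird_iprod.
Qed.

Lemma iprod_euler w g : iprod w (euler g) = - euler (iprod w g).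
Proof.
rewrite {2}/iprod [euler (\sum_j _)]linear_sum -sumrN {1}/iprod /=.
by apply: eq_bigr => j _; rewrite linearZ /= euler_contract_coord scalerN opprK.
Qed.

(** The commutator of D_w with [euler] is the contraction by w, which commutes with D_w. The factor
    n is the one in d(v^n) = n v^(n-1) dv. *)
Lemma iter_dird_euler n w g :
  iter n (dird w) (euler g) =
  euler (iter n (dird w) g) + n%:R *: iter n.-1 (dird w) (iprod w g).
Proof.
elim: n => [|n IHn]; first by rewrite scale0r addr0.
rewrite iterS IHn linearD linearZ /= dird_euler -addrA; congr (_ + _).
rewrite -(@iter_commute _ _ n w (iprod w)) => [|g']; last exact: dird_iprod.
case: n {IHn} => [|n] /=; first by rewrite scale0r addr0 scale1r.
by rewrite [in RHS]mulrS scalerDl scale1r.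
Qed.

Lemma deg_lt_euler w n g : deg_lt w n g -> deg_lt w n (euler g).
Proof.
case=> g1 g2; split.
  by rewrite iter_dird_euler g1 g2 !linear0 addr0.
rewrite iprod_euler linearN /= iter_dird_euler g2 iprod2 !linear0 ?addr0.
by rewrite oppr0.
Qed.

Lemma dird_parity w g : dird w (parity g) = parity (dird w g).
Proof.
rewrite /dird [parity (\sum_j _)]linear_sum; apply: eq_bigr => j _.
by rewrite linearZ /= -!dopX parity_dop.
Qed.

Lemma iprod_parity w g : iprod w (parity g) = - parity (iprod w g).
Proof.
rewrite /iprod [parity (\sum_j _)]linear_sum -sumrN; apply: eq_bigr => j _.
by rewrite linearZ /= parity_contract_coord scalerN opprK.
Qed.

Lemma deg_lt_parity w n g : deg_lt w n g -> deg_lt w n (parity g).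
Proof.
have C m h : iter m (dird w) (parity h) = parity (iter m (dird w) h).
  by apply: iter_commute => h'; rewrite dird_parity.
by case=> g1 g2; split; rewrite ?iprod_parity ?linearN /= C ?g1 ?g2 linear0 ?oppr0.
Qed.

Lemma deg_lt_dop w n p g : deg_lt w n g -> deg_lt w n (dop p g).
Proof.
move=> gn; elim/dop_ind: p => [||a p q pn qn|j p pn].
- by rewrite dop0l; apply: deg_lt_0.
- by rewrite dop1.
- by rewrite dopPl; apply: deg_ltD => //; apply: deg_ltZ.
- by rewrite dopM dopX -dird_delta; apply: deg_lt_dird.
Qed.

Lemma deg_lt_odot w n f g : deg_lt w n g -> deg_lt w n (odot f g).
Proof.
move=> gn; rewrite odotE; elim/big_ind: _ => [|x y|S _].
- exact: deg_lt_0.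
- exact: deg_ltD.
apply: deg_lt_dop; rewrite /sorted_prod; elim: (enum S) => //= j s IHs.
by rewrite -[contract_coord j _]iprod_delta; apply: deg_lt_iprod.
Qed.

(** A generator and its differential give the two halves of [deg_lt], the second after division by
    the exponent. Conversely, the forms with these bounds are stable under the action, [parity] and
    [euler], so their common annihilator is an ideal closed under d that contains the generators. *)
Lemma inverse_systemP (I : Type) (Q : I -> Prop) (c : I -> 'I_r -> K) (N : I -> nat) g :
  inverse_system (diff_closure (sym_ideal_gen
    (fun p => exists2 i, Q i & p = sym1 (c i) ^+ N i))) g <->
  forall i, Q i -> deg_lt (\row_j c i j) (N i) g.
Proof.
split=> [gI i Qi | gN f fI].
  set p := sym1 (c i) ^+ N i; set w := \row_j c i j.
  have pI : diff_closure (sym_ideal_gen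
      (fun p => exists2 i, Q i & p = sym1 (c i) ^+ N i)) (sup_sym p).
    by move=> J _ _; apply=> J' _; apply; exists i.
  have g1 : iter (N i) (dird w) g = 0.
    by have := gI _ pI; rewrite odot_sym dop_sym1.
  split=> //; have [N0|] := posnP (N i).
    by move: g1; rewrite N0 /= => ->; rewrite linear0.
  have dpI : diff_closure (sym_ideal_gen
      (fun p => exists2 i, Q i & p = sym1 (c i) ^+ N i)) (sup_d (sup_sym p)).
    by move=> J iJ dJ pJ; exact: (dJ _ (pI J iJ dJ pJ)).
  have := gI _ dpI; rewrite odot_d !odot_sym parity_dop parityK !dop_sym1.
  rewrite -/w g1 linear0 subr0 iter_dird_euler g1 linear0 add0r => /eqP.
  case: (N i) => // n; rewrite scaler_eq0 (negPf (natf_neq0 K0 n)) => /eqP ->.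
  by [].
pose J f := forall g, (forall i, Q i -> deg_lt (\row_j c i j) (N i) g) -> odot f g = 0.
suff: J f by apply.
apply: fI => {f g gN}.
- split=> [g _|f h Jf Jh g gN|f h Jh g gN|f h Jh g gN].
  + exact: odot0l.
  + by rewrite odotDl Jf // Jh // addr0.
  + by rewrite odot_mul Jh // linear0.
  + by rewrite odot_mul Jh // => i Qi; apply: deg_lt_odot; apply: gN.
- move=> f Jf g gN; rewrite odot_d (Jf g gN) (Jf (parity (euler g))).
    by rewrite !linear0 ?subr0 ?addr0.
  by move=> i Qi; apply/deg_lt_parity/deg_lt_euler/gN.
move=> p pI; apply: (pI (fun p => J (sup_sym p))).
  split=> [g _|p1 p2 J1 J2 g gN|p1 p2 J2 g gN]; rewrite odot_sym.
  - exact: dop0l.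
  - by rewrite -[p1]scale1r dopPl -!odot_sym J1 // J2 // scaler0 addr0.
  - by rewrite dopM -odot_sym -[dop p2 g]odot_sym J2 // linear0.
move=> q [i Qi ->] g gN; rewrite odot_sym dop_sym1.
by have [] := gN i Qi.
Qed.

End InverseSystem.

(** * Pullback of forms *)

Section Pullback.

Variable K : fieldType.
Hypothesis K0 : [pchar K] =i pred0.

Section PullbackDef.

Variables (q r : nat) (M : 'M[K]_(q, r)).
Implicit Types (f g h : superspace K r) (j k : 'I_r) (S T : {set 'I_r}).
Implicit Types (w : 'rV[K]_q) (c : 'cV[K]_r).

Definition wedge_col j : {linear superspace K q -> superspace K q} :=
  wedge (col j M).

Definition comp_cols : r.-tuple {mpoly K[q]} :=
  [tuple linp (col j M) | j < r].

(** The matrix M sends a row [w] to [w *m M], so a linear form [c] pulls back to [M *m c]. *)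
Definition pb g : superspace K q :=
  \sum_(S : {set 'I_r})
    pmul (g S \mPo comp_cols) (sorted_prod wedge_col S (sup1 K q)).

Lemma pb_is_linear : linear pb.
Proof.
move=> a f g; rewrite /pb scaler_sumr -big_split /=; apply: eq_bigr => S _.
by rewrite !ffunE linearP /= pmulDl pmulZl.
Qed.

HB.instance Definition _ :=
  GRing.isLinear.Build K (superspace K r) (superspace K q) _ pb pb_is_linear.

Lemma pbD f g : pb (f + g) = pb f + pb g.
Proof. exact: linearD. Qed.

Lemma pbB f g : pb (f - g) = pb f - pb g.
Proof. exact: linearB. Qed.

Lemma pbN f : pb (- f) = - pb f.
Proof. exact: linearN. Qed.

Lemma pb0 : pb 0 = 0.
Proof. exact: linear0. Qed.

Lemma pb_sup1 : pb (sup1 K r) = sup1 K q.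
Proof.
rewrite /pb (bigD1 set0) //= big1 ?addr0 => [|S nS0]; last first.
  by rewrite ffunE (negPf nS0) linear0 pmul0l.
by rewrite ffunE eqxx sorted_prod0 comp_mpoly1 pmul1.
Qed.

Lemma pbM p g : pb (pmul p g) = pmul (p \mPo comp_cols) (pb g).
Proof.
rewrite /pb linear_sum; apply: eq_bigr => S _.
by rewrite ffunE rmorphM /= pmulA.
Qed.

Lemma pbX j g : pb (pmul 'X_j g) = pmul (linp (col j M)) (pb g).
Proof. by rewrite pbM comp_mpolyXU -tnth_nth tnth_mktuple. Qed.

Lemma pb_wedge_coord j g : pb (wedge_coord j g) = wedge (col j M) (pb g).
Proof.
have wC i k x : i != k -> wedge_col i (wedge_col k x) = - wedge_col k (wedge_col i x).
  by move=> _; apply: wedgeC.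
have w2 i x : wedge_col i (wedge_col i x) = 0 by apply: wedge2.
rewrite /pb linear_sum /= (bigID (fun S : {set 'I_r} => j \in S)) /=.
rewrite [X in _ + X]big1 => [|S /negPf jS]; last by rewrite ffunE jS linear0 pmul0l.
rewrite addr0 [RHS](bigID (fun S : {set 'I_r} => j \in S)) /=.
rewrite [X in _ = X + _]big1 => [|S jS]; last first.
  by rewrite wedgeM [wedge _ _](sorted_prod_mem wC w2) // linear0.
rewrite add0r (reindex_onto (fun S => j |: S) (fun S => S :\ j)) /=; last first.
  by move=> S jS; rewrite setD1K.
apply: eq_big => [S|S].
  rewrite setU11 /=; apply/eqP/idP => [<-|jS]; first by rewrite !inE eqxx.
  by rewrite setU1K.
case/andP=> jS1 /eqP jS2; have jS : j \notin S by rewrite -jS2 !inE eqxx.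
rewrite ffunE jS1 jS2 linearZ /= pmulZl wedgeM.
by rewrite [wedge _ _](sorted_prodU1 wC) // linearZ.
Qed.

Lemma pb_linp c g : pb (pmul (linp c) g) = pmul (linp (M *m c)) (pb g).
Proof.
have -> : linp (M *m c) = \sum_j c j 0 *: linp (col j M).
  rewrite /linp /sym1; under [RHS]eq_bigr do rewrite scaler_sumr.
  rewrite exchange_big /=; apply: eq_bigr => i _.
  rewrite mxE scaler_suml; apply: eq_bigr => j _.
  by rewrite mxE scalerA mulrC.
rewrite /linp /sym1 !pmul_suml linear_sum; apply: eq_bigr => j _.
by rewrite !pmulZl linearZ /= pbX.
Qed.

Lemma pb_wedge c g : pb (wedge c g) = wedge (M *m c) (pb g).
Proof.
have -> : wedge (M *m c) (pb g) = \sum_j c j 0 *: wedge (col j M) (pb g).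
  rewrite /wedge; under [RHS]eq_bigr do rewrite scaler_sumr.
  rewrite exchange_big /=; apply: eq_bigr => i _.
  rewrite mxE scaler_suml; apply: eq_bigr => j _.
  by rewrite mxE scalerA mulrC.
rewrite {1}/wedge linear_sum; apply: eq_bigr => j _.
by rewrite linearZ /= pb_wedge_coord.
Qed.

Lemma mulmx_col0 w j : ev (col j M) w = (w *m M) 0 j.
Proof. by rewrite evE mxE; apply: eq_bigr => i _; rewrite mxE. Qed.

Lemma ev_mulmx c w : ev (M *m c) w = ev c (w *m M).
Proof. by rewrite /ev mulmxA. Qed.

Lemma dird_pb w g : dird w (pb g) = pb (dird (w *m M) g).
Proof.
elim/superspace_ind: g => [f g IHf IHg|a f IH||j f IH|j f IH].
- by rewrite !linearD /= IHf IHg.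
- by rewrite !linearZ /= IH.
- by rewrite pb_sup1 !dird_sup1 linear0.
- rewrite pbX dird_linp -[in RHS]linp_delta dird_linp linearD linearZ /=.
  by rewrite linp_delta pbX IH -ev_mulmx -colE.
- by rewrite pb_wedge_coord dird_wedge IH -wedge_delta dird_wedge wedge_delta pb_wedge_coord.
Qed.

Lemma iprod_pb w g : iprod w (pb g) = pb (iprod (w *m M) g).
Proof.
elim/superspace_ind: g => [f g IHf IHg|a f IH||j f IH|j f IH].
- by rewrite !linearD /= IHf IHg.
- by rewrite !linearZ /= IH.
- by rewrite pb_sup1 !iprod_sup1 linear0.
- by rewrite pbX iprodM IH -pbX -iprodM.
- rewrite pb_wedge_coord iprod_wedge IH iprod_wedge_coord linearB linearZ /=.
  by rewrite pb_wedge_coord mulmx_col0.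
Qed.

Lemma deg_lt_pb w n g : deg_lt (w *m M) n g -> deg_lt w n (pb g).
Proof.
have C m h : iter m (dird w) (pb h) = pb (iter m (dird (w *m M)) h).
  by elim: m => //= m ->; rewrite dird_pb.
by case=> g1 g2; split; rewrite ?iprod_pb C ?g1 ?g2 linear0.
Qed.

End PullbackDef.

Lemma pb_comp q r s (N : 'M[K]_(q, r)) (M : 'M[K]_(r, s)) g :
  pb N (pb M g) = pb (N *m M) g.
Proof.
have colM j : N *m col j M = col j (N *m M) by rewrite !colE mulmxA.
elim/superspace_ind: g => [f g IHf IHg|a f IH||j f IH|j f IH].
- by rewrite !linearD /= IHf IHg.
- by rewrite !linearZ /= IH.
- by rewrite !pb_sup1.
- by rewrite !pbX pb_linp IH colM.
- by rewrite !pb_wedge_coord pb_wedge IH colM.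
Qed.

Lemma pb1 r g : pb (1%:M : 'M[K]_r) g = g.
Proof.
have col1 j : col j (1%:M : 'M[K]_r) = delta_mx j 0 by rewrite colE mul1mx.
elim/superspace_ind: g => [f g IHf IHg|a f IH||j f IH|j f IH].
- by rewrite !linearD /= IHf IHg.
- by rewrite !linearZ /= IH.
- by rewrite pb_sup1.
- by rewrite pbX IH col1 linp_delta.
- by rewrite pb_wedge_coord IH col1 wedge_delta.
Qed.

(** * Restriction to a hyperplane as a projection *)

Section Projection.

Variables (r : nat) (b : 'cV[K]_r) (v : 'rV[K]_r).
Hypothesis bv : ev b v = 1.
Implicit Types (g h : superspace K r) (w : 'rV[K]_r).

(** On rows this is w |-> w - b(w) v, the projection onto ker b along v. Pullback along it stands
    for restriction to ker b, the result being still a form on the whole space. *)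
Definition proj : 'M[K]_r := 1%:M - b *m v.

Lemma mul_proj w : w *m proj = w - ev b w *: v.
Proof.
rewrite mulmxBr mulmx1 mulmxA; congr (_ - _).
by rewrite [w *m b]mx11_scalar mul_scalar_mx.
Qed.

Lemma proj_v : v *m proj = 0.
Proof. by rewrite mul_proj bv scale1r subrr. Qed.

Lemma proj_b : proj *m b = 0.
Proof.
by rewrite mulmxBl mul1mx -mulmxA [v *m b]mx11_scalar -/(ev b v) bv mulmx1 subrr.
Qed.

Lemma ev_proj w : ev b (w *m proj) = 0.
Proof. by rewrite -ev_mulmx proj_b ev0l. Qed.

Lemma proj_id w : ev b w = 0 -> w *m proj = w.
Proof. by rewrite mul_proj => ->; rewrite scale0r subr0. Qed.

Lemma proj_fix (c : 'cV[K]_r) : ev c v = 0 -> proj *m c = c.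
Proof.
move=> cv; rewrite mulmxBl mul1mx -mulmxA [v *m c]mx11_scalar -/(ev c v) cv.
by rewrite raddf0 mulmx0 subr0.
Qed.

Lemma proj_proj : proj *m proj = proj.
Proof. by rewrite {1}/proj mulmxBl mul1mx -mulmxA proj_v mulmx0 subr0. Qed.

Lemma delta_proj j : delta_mx j 0 = v 0 j *: b + col j proj.
Proof.
rewrite colE mulmxBl mul1mx -mulmxA -colE [col j v]mx11_scalar mul_mx_scalar mxE.
by rewrite addrC subrK.
Qed.

(** Each coordinate form is a multiple of b plus its composite with the projection, so modulo b and
    db every form equals its pullback. *)
Lemma restrict_decomp h :
  exists h1 h2, h = pb proj h + pmul (linp b) h1 + wedge b h2.
Proof.
elim/superspace_ind: h => [f g [f1 [f2 ef]] [g1 [g2 eg]]|a f [f1 [f2 ef]]||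
  j f [f1 [f2 ef]]|j f [f1 [f2 ef]]].
- exists (f1 + g1), (f2 + g2); rewrite !linearD /= {1}ef {1}eg.
  by rewrite addrACA; congr (_ + _); apply: addrACA.
- by exists (a *: f1), (a *: f2); rewrite !linearZ /= {1}ef !scalerDr.
- by exists 0, 0; rewrite pb_sup1 !linear0 !addr0.
- exists (pmul (linp (col j proj)) f1 + v 0 j *: f), (pmul (linp (col j proj)) f2).
  rewrite -{1}linp_delta delta_proj linpPl pmulDl pmulZl {2}ef pbX.
  move: (col j proj) => c; rewrite !linearD /= wedgeM !pmulA [linp b * _]mulrC linearZ /=.
  by rewrite [LHS]addrC -!addrA; congr (_ + (_ + _)); rewrite addrC.
- exists (wedge (col j proj) f1), (v 0 j *: f - wedge (col j proj) f2).
  rewrite -{1}wedge_delta delta_proj wedgePl // {2}ef pb_wedge_coord.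
  move: (col j proj) => c; rewrite !linearD /= wedgeM linearN linearZ /=.
  rewrite [wedge _ (wedge b _)]wedgeC //.
  by rewrite [LHS]addrC -!addrA; congr (_ + (_ + _)); rewrite addrC.
Qed.

Lemma restrict_eq0 h : pb proj h = 0 -> exists h1, h = pmul (linp b) h1 + wedge b (iprod v h).
Proof.
move=> h0; have [h1 [h2 eh]] := restrict_decomp h; rewrite h0 add0r in eh.
exists (h1 - wedge b (iprod v h1)).
have -> : iprod v h = pmul (linp b) (iprod v h1) + (h2 - wedge b (iprod v h2)).
  by rewrite eh linearD /= iprodM iprod_wedge bv scale1r.
rewrite {1}eh [pmul _ (_ - _)]linearB /= linearD /= wedgeM linearB /= wedge2 //.
by rewrite subr0 addrA subrK.
Qed.

(** This is exactness in the middle. The contraction of h by v has itself zero contraction, so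
    [restrict_eq0] makes it a multiple of b; the remaining term db wedged with it is then divisible
    by b too. *)
Lemma restrict_eq0_linp h : pb proj h = 0 -> pb proj (iprod v h) = 0 ->
  exists x, h = pmul (linp b) x.
Proof.
move=> /restrict_eq0[h1 eh] /restrict_eq0[h2]; rewrite iprod2 linear0 addr0 => eh2.
exists (h1 + wedge b h2).
by rewrite {1}eh eh2 linearD /= wedgeM.
Qed.

End Projection.

End Pullback.

(** * Bihomogeneous components *)

Section Bigrading.

Variable K : fieldType.

Section Component.

Variable r : nat.
Implicit Types (f g h : superspace K r) (j k : 'I_r) (S T : {set 'I_r}).
Implicit Types (w u v : 'rV[K]_r) (p q : {mpoly K[r]}) (a b : int).

(** Degrees are integers as in the bigrading of the sequence; components of negative degree are 0,
    so the shift a - 1 needs no side condition. *)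
Definition pihomz a p : {mpoly K[r]} :=
  if a is Posz n then pihomog mdeg n p else 0.

Lemma pihomz_is_linear a : linear (pihomz a).
Proof. by case: a => n c p q; rewrite /pihomz ?linearP // scaler0 addr0. Qed.

HB.instance Definition _ a :=
  GRing.isLinear.Build K {mpoly K[r]} {mpoly K[r]} _ (pihomz a)
    (pihomz_is_linear a).

Lemma pihomzX a m : pihomz a 'X_[m] = if (mdeg m)%:Z == a then 'X_[m] else 0.
Proof. by case: a => n //=; rewrite pihomogX. Qed.

Lemma mcoeff_pihomz a p m : (pihomz a p)@_m = if (mdeg m)%:Z == a then p@_m else 0.
Proof.
elim/mpolyind: p => [|c m' p _ _ IHp]; first by rewrite linear0 mcoeff0; case: ifP.
rewrite linearP /= !mcoeffD !mcoeffZ {}IHp pihomzX.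
have [<-|nm] := eqVneq m' m; first by case: eqP => _; rewrite ?mcoeff0 ?mulr0 ?addr0.
have -> : ('X_[m'] : {mpoly K[r]})@_m = 0 by rewrite mcoeffX (negPf nm).
have -> : (if (mdeg m')%:Z == a then 'X_[m'] else 0 : {mpoly K[r]})@_m = 0.
  by case: ifP => _; rewrite ?mcoeff0 // mcoeffX (negPf nm).
by case: ifP => _; rewrite mulr0 !add0r.
Qed.

Lemma pihomz_mulX a j p : pihomz a ('X_j * p) = 'X_j * pihomz (a - 1) p.
Proof.
elim/mpolyind: p => [|c m p _ _ IHp]; first by rewrite mulr0 !linear0 mulr0.
rewrite mulrDr -scalerAr linearP /= [in RHS]linearP /= mulrDr -scalerAr {}IHp.
congr (_ *: _ + _); rewrite -mpolyXD !pihomzX mdegD mdeg1 PoszD addrC.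
by rewrite -subr_eq [in RHS]fun_if mulr0 -mpolyXD; case: ifP.
Qed.

Definition bicomp a b g : superspace K r :=
  [ffun S : {set 'I_r} => if (#|S|)%:Z == b then pihomz a (g S) else 0].

Lemma bicomp_is_linear a b : linear (bicomp a b).
Proof.
move=> c f g; apply/ffunP=> S; rewrite !ffunE linearP; case: ifP => //.
by rewrite scaler0 addr0.
Qed.

HB.instance Definition _ a b :=
  GRing.isLinear.Build K (superspace K r) (superspace K r) _ (bicomp a b)
    (bicomp_is_linear a b).

Lemma bihomogeneousP a b g : bihomogeneous a b g <-> bicomp a b g = g.
Proof.
split=> [gab|<- S m].
  apply/ffunP=> S; apply/mpolyP=> m; rewrite ffunE; have := gab S m.
  have [e|nz] := eqVneq ((g S)@_m) 0; last first.
    by move=> /(_ isT)[<- <-]; rewrite eqxx mcoeff_pihomz eqxx.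
  move=> _; case: ifP => _; last by rewrite mcoeff0.
  by rewrite mcoeff_pihomz e; case: ifP.
rewrite ffunE; case: ifP => [/eqP eS|_]; last by rewrite mcoeff0 eqxx.
by rewrite mcoeff_pihomz; case: ifP => [/eqP|]; rewrite ?eqxx.
Qed.

Lemma bicomp_mulX a b j g : bicomp a b (pmul 'X_j g) = pmul 'X_j (bicomp (a - 1) b g).
Proof.
apply/ffunP=> S; rewrite !ffunE; case: ifP => _; last by rewrite mulr0.
exact: pihomz_mulX.
Qed.

Lemma bicomp_wedge_coord a b j g :
  bicomp a b (wedge_coord j g) = wedge_coord j (bicomp a (b - 1) g).
Proof.
apply/ffunP=> S; rewrite !ffunE; have [jS|jS] := boolP (j \in S); last first.
  by rewrite linear0; case: ifP.
rewrite (cardsD1 j S) jS PoszD addrC -subr_eq; case: ifP => _; last by rewrite scaler0.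
by rewrite linearZ.
Qed.

Lemma bicomp_sup1 a b :
  bicomp a b (sup1 K r) = ((a == 0) && (b == 0))%:R *: sup1 K r.
Proof.
apply/ffunP=> S; rewrite !ffunE; case: (S =P set0) => [->|]; last first.
  by rewrite linear0 scaler0; case: ifP.
rewrite cards0 [_ == b]eq_sym; case: (b == 0); last by rewrite andbF scale0r.
rewrite -mpolyX0 pihomzX mdeg0 [_ == a]eq_sym andbT.
by case: (a == 0); rewrite ?scale1r ?scale0r.
Qed.

Lemma bicomp_linp a b c g :
  bicomp a b (pmul (linp c) g) = pmul (linp c) (bicomp (a - 1) b g).
Proof.
rewrite /linp /sym1 !pmul_suml linear_sum; apply: eq_bigr => j _.
by rewrite !pmulZl linearZ /= bicomp_mulX.
Qed.

Lemma bicomp_wedge a b c g :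
  bicomp a b (wedge c g) = wedge c (bicomp a (b - 1) g).
Proof.
rewrite /wedge linear_sum; apply: eq_bigr => j _.
by rewrite linearZ /= bicomp_wedge_coord.
Qed.

Lemma dird_bicomp a b w g : dird w (bicomp a b g) = bicomp (a - 1) b (dird w g).
Proof.
elim/superspace_ind: g a b => [f g IHf IHg|c f IH||j f IH|j f IH] a b.
- by rewrite !linearD /= IHf IHg.
- by rewrite !linearZ /= IH.
- by rewrite bicomp_sup1 linearZ /= dird_sup1 !linear0.
- rewrite bicomp_mulX -linp_delta !dird_linp IH linearD linearZ /=.
  by rewrite linp_delta bicomp_mulX.
- by rewrite bicomp_wedge_coord -!wedge_delta !dird_wedge IH bicomp_wedge.
Qed.

Lemma iprod_bicomp a b w g : iprod w (bicomp a b g) = bicomp a (b - 1) (iprod w g).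
Proof.
elim/superspace_ind: g a b => [f g IHf IHg|c f IH||j f IH|j f IH] a b.
- by rewrite !linearD /= IHf IHg.
- by rewrite !linearZ /= IH.
- by rewrite bicomp_sup1 linearZ /= iprod_sup1 !linear0.
- by rewrite bicomp_mulX !iprodM IH bicomp_mulX.
- rewrite bicomp_wedge_coord !iprod_wedge_coord IH linearB linearZ /=.
  by rewrite bicomp_wedge_coord.
Qed.

Lemma deg_lt_bicomp a b w n g : deg_lt w n g -> deg_lt w n (bicomp a b g).
Proof.
have C m a' b' h : iter m (dird w) (bicomp a' b' h) =
    bicomp (a' - m%:Z) b' (iter m (dird w) h).
  elim: m => [|m IHm] /=; first by rewrite subr0.
  by rewrite IHm dird_bicomp -addrA -opprD -addn1 PoszD.
by case=> g1 g2; split; rewrite ?iprod_bicomp C ?g1 ?g2 linear0.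
Qed.

End Component.

Lemma bicomp_pb (K0 : [pchar K] =i pred0) q r (M : 'M[K]_(q, r)) a b g :
  bicomp a b (pb M g) = pb M (bicomp a b g).
Proof.
elim/superspace_ind: g a b => [f g IHf IHg|c f IH||j f IH|j f IH] a b.
- by rewrite !linearD /= IHf IHg.
- by rewrite !linearZ /= IH.
- by rewrite bicomp_sup1 linearZ /= !pb_sup1 bicomp_sup1.
- by rewrite bicomp_mulX !pbX bicomp_linp IH.
- by rewrite bicomp_wedge_coord !pb_wedge_coord // bicomp_wedge IH.
Qed.

End Bigrading.

(** * From vector spaces to coordinates *)

Section VectorSpaces.

Variable K : fieldType.

Section Coordinates.

Variable V : vectType K.
Implicit Types (v w : V) (f : 'Hom(V, K^o)) (g : Psi_dual V).

Definition rv v : 'rV[K]_(\dim {:V}) := \row_j vcoord v j.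

Definition fcol f : 'cV[K]_(\dim {:V}) := \col_j form_coord f j.

Lemma rv_basis v : v = \sum_j rv v 0 j *: tnth (vbasis {:V}) j.
Proof.
rewrite {1}(coord_vbasis (memvf v)); apply: eq_bigr => j _.
by rewrite mxE (tnth_nth 0).
Qed.

Lemma rv_is_linear : linear rv.
Proof. by move=> a v w; apply/rowP=> j; rewrite !mxE /vcoord linearP. Qed.

HB.instance Definition _ :=
  GRing.isLinear.Build K V 'rV[K]_(\dim {:V}) _ rv rv_is_linear.

Lemma rv_inj : injective rv.
Proof. by move=> v w e; rewrite (rv_basis v) (rv_basis w) e. Qed.

Lemma rv_surj (x : 'rV[K]_(\dim {:V})) : exists v, x = rv v.
Proof.
exists (\sum_j x 0 j *: tnth (vbasis {:V}) j); apply/rowP=> j.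
rewrite mxE /vcoord; under eq_bigr do rewrite (tnth_nth 0).
by rewrite coord_sum_free //; apply: basis_free (vbasisP _).
Qed.

Lemma rv_eq0 v : (rv v == 0) = (v == 0).
Proof. by rewrite -(inj_eq rv_inj) linear0. Qed.

Lemma ev_fcol f v : ev (fcol f) (rv v) = f v.
Proof.
rewrite evE {2}(rv_basis v) linear_sum /=; apply: eq_bigr => j _.
by rewrite linearZ !mxE.
Qed.

Lemma sup_mul_sym p (g : superspace K (\dim {:V})) : sup_mul (sup_sym p) g = pmul p g.
Proof.
apply/ffunP=> S; rewrite !ffunE (bigD1 set0) ?powersetE ?sub0set //= big1.
  by rewrite ffunE eqxx inversions0s expr0 scale1r setD0 addr0.
by move=> A /andP[_ /negPf nA]; rewrite ffunE nA mul0r scaler0.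
Qed.

Lemma sup_mul_ext1 (c : 'I_(\dim {:V}) -> K) (g : superspace K (\dim {:V})) :
  sup_mul (ext1 c) g = wedge (\col_j c j) g.
Proof.
apply/ffunP=> S; rewrite sum_ffunE ffunE.
transitivity (\sum_(A in powerset S) \sum_(j | A == [set j])
    c j *: ((-1) ^+ inversions [set j] (S :\ j) *: g (S :\ j))).
  apply: eq_bigr => A _; rewrite ffunE mulr_suml scaler_sumr.
  apply: eq_bigr => j /eqP ->; rewrite mul_mpolyC !scalerA.
  by rewrite mulrC.
rewrite (exchange_big_dep xpredT) //=; apply: eq_bigr => j _.
rewrite !ffunE mxE; have [jS|jS] := boolP (j \in S).
  rewrite (big_pred1 [set j]) // => A; rewrite powersetE /=.
  by have [->|_] := eqVneq A [set j]; rewrite ?andbF // sub1set jS.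
rewrite scaler0 big1 // => A; rewrite powersetE => /andP[AS /eqP eA].
by move: AS; rewrite eA sub1set (negPf jS).
Qed.

Lemma mul_formE f g : mul_form f g = pmul (linp (fcol f)) g.
Proof.
rewrite /mul_form sup_mul_sym; congr (pmul _ g); rewrite /linp /sym1.
by apply: eq_bigr => j _; rewrite mxE.
Qed.

Lemma contractE v g : contract v g = iprod (rv v) g.
Proof.
apply/ffunP=> S; rewrite ffunE /iprod sum_ffunE; apply: eq_bigr => j _.
by rewrite [in RHS]ffunE mxE.
Qed.

End Coordinates.

Section Homs.

Variables (W V : vectType K) (phi : 'Hom(W, V)).

Definition mxhom : 'M[K]_(\dim {:W}, \dim {:V}) :=
  \matrix_(k, j) pullback_coord phi j k.

Lemma rv_mxhom w : rv w *m mxhom = rv (phi w).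
Proof.
rewrite {2}(rv_basis w) !linear_sum /=; apply/rowP=> j.
rewrite mxE summxE; apply: eq_bigr => k _.
by rewrite !linearZ !mxE.
Qed.

Lemma mxhom_fcol (f : 'Hom(V, K^o)) : mxhom *m fcol f = fcol (f \o phi)%VF.
Proof.
apply/colP=> k; rewrite [RHS]mxE /form_coord comp_lfunE -ev_fcol evE mxE.
by apply: eq_bigr => j _; rewrite !mxE.
Qed.

Lemma pullbackE (g : Psi_dual V) : pullback phi g = pb mxhom g.
Proof.
have tE : [tuple sym1 (pullback_coord phi j) | j < \dim {:V}] = comp_cols mxhom.
  apply: eq_mktuple => j; rewrite /linp /sym1; apply: eq_bigr => k _.
  by rewrite !mxE.
rewrite /pullback tE /pb; apply: eq_bigr => S _; rewrite sup_mul_sym.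
congr (pmul _ _); rewrite -big_filter deprecated_filter_index_enum /sorted_prod /=; elim: (enum S) => [|j s IHs].
  by rewrite big_nil.
rewrite big_cons /= IHs sup_mul_ext1; congr (wedge _ _).
by apply/colP=> k; rewrite !mxE.
Qed.

End Homs.

End VectorSpaces.

(** * Arrangements *)

Opaque pb dird iprod wedge pmul.

Section Arrangements.

Variable K : fieldType.
Hypothesis K0 : [pchar K] =i pred0.

Section Spaces.

Variable r : nat.
Implicit Types (s t : seq 'cV[K]_r) (c b : 'cV[K]_r) (u v w : 'rV[K]_r).
Implicit Types (f g h x y z : superspace K r).

Definition rhos s w : nat := count (fun c => ev c w != 0) s.

(* These are the spaces C_{L,0} and C_{L,-1} of the arrangement s; if s is not
   essential, they consist of the forms pulled back from its essentialization. *)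
Definition ext_space s g := forall w, deg_lt w (rhos s w).+1 g.
Definition cen_space s g := forall w, deg_lt w (maxn (rhos s w) 1) g.

Lemma rhos_eq0P s w : rhos s w = 0 <-> {in s, forall c, ev c w = 0}.
Proof.
split=> [/eqP|s0]; last first.
  apply/eqP; rewrite -leqn0 leqNgt -has_count; apply/hasPn=> c /s0 ->.
  by rewrite eqxx.
rewrite -leqn0 leqNgt -has_count => /hasPn s0 c /s0; rewrite negbK.
by move/eqP.
Qed.

Lemma rhos_cons0 s w : rhos (0 :: s) w = rhos s w.
Proof. by rewrite /= ev0l eqxx. Qed.

Lemma exists_ev1 c : c != 0 -> exists u, ev c u = 1.
Proof.
move=> c0; have [w cw] : exists w, ev c w != 0.
  apply: boolp.contrapT => nw; move/eqP: c0; apply; apply: ev_eq0P => w.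
  by apply/eqP; apply: boolp.contrapT => cw; apply: nw; exists w; apply/negP.
by exists ((ev c w)^-1 *: w); rewrite evZr mulVf.
Qed.

Lemma ext_space_eq s t g : rhos s =1 rhos t -> ext_space s g -> ext_space t g.
Proof. by move=> st sg w; rewrite -st. Qed.

Lemma cen_space_eq s t g : rhos s =1 rhos t -> cen_space s g -> cen_space t g.
Proof. by move=> st sg w; rewrite -st. Qed.

Lemma ext_spaceD s f g : ext_space s f -> ext_space s g -> ext_space s (f + g).
Proof. by move=> sf sg w; apply: deg_ltD. Qed.

Lemma ext_spaceB s f g : ext_space s f -> ext_space s g -> ext_space s (f - g).
Proof. by move=> sf sg w; apply: deg_ltB. Qed.

Lemma ext_spaceN s g : ext_space s g -> ext_space s (- g).
Proof. by move=> sg w; apply: deg_ltN. Qed.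

Lemma ext_space_iprod s u g : ext_space s g -> ext_space s (iprod u g).
Proof. by move=> sg w; apply: deg_lt_iprod. Qed.

Lemma cen_spaceB s f g : cen_space s f -> cen_space s g -> cen_space s (f - g).
Proof. by move=> sf sg w; apply: deg_ltB. Qed.

Lemma cen_spaceZ s a g : cen_space s g -> cen_space s (a *: g).
Proof. by move=> sg w; apply: deg_ltZ. Qed.

Lemma cen_space_iprod s u g : cen_space s g -> cen_space s (iprod u g).
Proof. by move=> sg w; apply: deg_lt_iprod. Qed.

Lemma ext_space_cons s c g : ext_space s g -> ext_space (c :: s) g.
Proof. by move=> sg w; apply: deg_ltW (sg w) => //=; rewrite ltnS leq_addl. Qed.

Lemma ext_space_linp s c g : ext_space s g -> ext_space (c :: s) (pmul (linp c) g).
Proof. by move=> sg w; rewrite /= -addnS; apply: deg_lt_linp. Qed.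

Lemma ext_space_wedge s c g : ext_space s g -> ext_space (c :: s) (wedge c g).
Proof. by move=> sg w; rewrite /= -addnS; apply: deg_lt_wedge. Qed.

Lemma ext_space_linp_inv s c g : c != 0 ->
  ext_space (c :: s) (pmul (linp c) g) -> ext_space s g.
Proof. by move=> c0 sg w; apply: deg_lt_linp_inv c0 _ => //; rewrite addnS. Qed.

Lemma cen_space_linp_inv s c g : c != 0 ->
  cen_space (c :: s) (pmul (linp c) g) -> cen_space s g.
Proof.
move=> c0 sg w; have := sg w; rewrite /=; have [cw|cw] := eqVneq (ev c w) 0.
  by move=> gw; apply: (@deg_lt_linp_inv _ _ K0 _ _ c) => //; rewrite cw eqxx.
rewrite add1n (maxn_idPl _) // => gw; apply: (@deg_ltW _ _ _ (rhos s w)); first exact: leq_maxl.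
by apply: (@deg_lt_linp_inv _ _ K0 _ _ c) => //; rewrite cw.
Qed.

(** The span of products is encoded by recursion: a product omits the leading form, contains it as a
    factor, or contains its differential. *)
Fixpoint products s g : Prop :=
  if s is c :: s' then
    exists g0 g1 g2, [/\ products s' g0, products s' g1, products s' g2 &
      g = g0 + pmul (linp c) g1 + wedge c g2]
  else exists a, g = a *: sup1 K r.

Lemma products0 s : products s 0.
Proof.
elim: s => [|c s IHs] /=; first by exists 0; rewrite scale0r.
by exists 0, 0, 0; split=> //; rewrite !linear0 !addr0.
Qed.

Lemma products_ext s g : products s g -> ext_space s g.
Proof.
elim: s g => [g [a ->] w|c s IHs g [g0 [g1 [g2 [s0 s1 s2 ->]]]]].
  by apply: deg_ltZ; split; rewrite /= ?dird_sup1 ?iprod_sup1.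
apply: ext_spaceD; last exact/ext_space_wedge/IHs.
by apply: ext_spaceD; [apply/ext_space_cons/IHs | apply/ext_space_linp/IHs].
Qed.

(* On a product of forms in s with total degree rhos s w along w, a derivation
   along u differentiates a factor that is constant along w, hence along u. *)
Lemma products_flat s g u w : products s g ->
  {in s, forall c, ev c w = 0 -> ev c u = 0} ->
  deg_lt w (rhos s w) (iprod u g) /\ deg_lt w (rhos s w) (dird u g).
Proof.
elim: s g => [g [a ->] _|c s IHs g [g0 [g1 [g2 [s0 s1 s2 ->]]]] wu].
  by rewrite !linearZ /= dird_sup1 iprod_sup1 scaler0; split; apply: deg_lt_0.
have wu' : {in s, forall c, ev c w = 0 -> ev c u = 0}.
  by move=> d ds; apply: wu; rewrite inE ds orbT.
have [i0 d0] := IHs _ s0 wu'; have [i1 d1] := IHs _ s1 wu'.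
have [i2 d2] := IHs _ s2 wu'.
have le_rho : (rhos s w <= rhos (c :: s) w)%N by rewrite /= leq_addl.
have cuZ g' : products s g' -> deg_lt w (rhos (c :: s) w) (ev c u *: g').
  move=> s'; have [cw|cw] := eqVneq (ev c w) 0.
    by rewrite wu ?mem_head // scale0r; apply: deg_lt_0.
  by apply: deg_ltZ; rewrite /= cw add1n; apply: products_ext.
rewrite !iprodD iprodM iprod_wedge !linearD /= dird_linp dird_wedge.
split; last first.
  apply: deg_ltD; last exact: deg_lt_wedge.
  apply: deg_ltD; first exact: deg_ltW d0.
  by apply: deg_ltD; [apply: deg_lt_linp | apply: cuZ].
apply: deg_ltD; last by apply: deg_ltB; [apply: cuZ | apply: deg_lt_wedge].
by apply: deg_ltD; [apply: deg_ltW i0 | apply: deg_lt_linp].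
Qed.

End Spaces.

Section Maps.

Variables (q r : nat) (M : 'M[K]_(q, r)).
Implicit Types (s : seq 'cV[K]_r) (g : superspace K r) (w : 'rV[K]_q).

Lemma rhos_map s w : rhos [seq M *m c | c <- s] w = rhos s (w *m M).
Proof. by rewrite /rhos count_map; apply: eq_count => c /=; rewrite ev_mulmx. Qed.

Lemma ext_space_pb s g : ext_space s g -> ext_space [seq M *m c | c <- s] (pb M g).
Proof. by move=> sg w; rewrite rhos_map; apply: deg_lt_pb. Qed.

Lemma cen_space_pb s g : cen_space s g -> cen_space [seq M *m c | c <- s] (pb M g).
Proof. by move=> sg w; rewrite rhos_map; apply: deg_lt_pb. Qed.

(** Each factor lifts separately: a product of pulled back forms and differentials is the pullback
    of the same product. *)
Lemma products_pb_surj s h : products [seq M *m c | c <- s] h ->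
  exists2 g, products s g & h = pb M g.
Proof.
elim: s h => [h [a ->]|c s IHs h [h0 [h1 [h2 [s0 s1 s2 ->]]]]].
  by exists (a *: sup1 K r); [exists a | rewrite linearZ /= pb_sup1].
have [g0 p0 ->] := IHs _ s0; have [g1 p1 ->] := IHs _ s1.
have [g2 p2 ->] := IHs _ s2.
exists (g0 + pmul (linp c) g1 + wedge c g2); first by exists g0, g1, g2.
by rewrite !pbD pb_linp // pb_wedge.
Qed.

End Maps.

Section Theory.

Variable r : nat.
Implicit Types (s t : seq 'cV[K]_r) (c b : 'cV[K]_r) (u v w : 'rV[K]_r).
Implicit Types (f g h x y z : superspace K r).

Lemma ext_space_proj s c u g : ev c u = 1 -> ext_space (c :: s) g ->
  ext_space [seq proj c u *m d | d <- s] (pb (proj c u) g).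
Proof.
move=> cu /(ext_space_pb (proj c u)) /=; rewrite proj_b //.
by apply: ext_space_eq => w; apply: rhos_cons0.
Qed.

Lemma cen_space_proj s c u g : ev c u = 1 -> cen_space (c :: s) g ->
  cen_space [seq proj c u *m d | d <- s] (pb (proj c u) g).
Proof.
move=> cu /(cen_space_pb (proj c u)) /=; rewrite proj_b //.
by apply: cen_space_eq => w; apply: rhos_cons0.
Qed.

Lemma neq0_of_ev c u : ev c u = 1 -> c != 0.
Proof. by apply: contra_eq_neq => ->; rewrite ev0l eq_sym oner_eq0. Qed.

(** By induction, the restriction of g to ker c is a combination of products and lifts to y0;
    likewise the contraction of g - y0 lifts to y1. Then g - y0 - dc y1 vanishes on ker c together
    with its contraction, so it is c x, and x obeys the bounds of s. The induction is on the length
    because the projected list is not a part of s. *)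
Lemma ext_space_products s g : ext_space s g -> products s g.
Proof.
have [n] := ubnP (size s); elim: n s g => // n IHn [|c s] g /=.
  by move=> _ sg; apply: constant_form.
rewrite ltnS => ltsn sg; have [c0|c0] := eqVneq c 0.
  exists g, 0, 0; rewrite !linear0 !addr0; split=> //; try exact: products0.
  apply: IHn => //; apply: ext_space_eq sg => w; rewrite c0; exact: rhos_cons0.
have [u cu] := exists_ev1 c0.
have lift h : ext_space (c :: s) h ->
    exists2 h', products s h' & pb (proj c u) h = pb (proj c u) h'.
  move=> sh; apply: products_pb_surj; apply: IHn; first by rewrite size_map.
  exact: ext_space_proj.
have [y0 s0 e0] := lift g sg.
have sg1 := ext_spaceB sg (ext_space_cons c (products_ext s0)).
have [y1 s1 e1] := lift _ (ext_space_iprod u sg1).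
have sg2 := ext_spaceB sg1 (ext_space_wedge c (products_ext s1)).
have r1 : pb (proj c u) (g - y0 - wedge c y1) = 0.
  by rewrite !pbB (pb_wedge K0) (proj_b cu) wedge0l e0 subrr subr0.
have r2 : pb (proj c u) (iprod u (g - y0 - wedge c y1)) = 0.
  rewrite iprodB pbB e1 iprod_wedge cu scale1r pbB (pb_wedge K0) (proj_b cu) wedge0l.
  by rewrite subr0 subrr.
have [x ex] := restrict_eq0_linp K0 cu r1 r2; rewrite ex in sg2.
exists y0, x, y1; split; [exact: s0| |exact: s1|].
  by apply: (IHn _ _ ltsn); apply: (ext_space_linp_inv c0 sg2).
by rewrite -ex -addrA subrK addrC subrK.
Qed.

Lemma ext_space_pb_surj s (M : 'M[K]_r) h : ext_space [seq M *m c | c <- s] h ->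
  exists2 g, ext_space s g & pb M g = h.
Proof.
by move=> /ext_space_products/products_pb_surj[g /products_ext sg ->]; exists g.
Qed.

Lemma ext_space_flat s g u w : ext_space s g ->
  {in s, forall c, ev c w = 0 -> ev c u = 0} ->
  deg_lt w (rhos s w) (iprod u g) /\ deg_lt w (rhos s w) (dird u g).
Proof. by move=> /ext_space_products; apply: products_flat. Qed.

End Theory.

End Arrangements.

(** * Multiplication by a generic form *)

Section CentralSpaces.

Variables (K : fieldType) (r : nat).
Hypothesis K0 : [pchar K] =i pred0.
Implicit Types (s t : seq 'cV[K]_r) (c b : 'cV[K]_r) (u v w : 'rV[K]_r).
Implicit Types (f g h x y z : superspace K r).

(** The two lifts y0 and y1 are chosen independently. The correction by dc vanishes on ker c and
    changes the restricted contraction from that of y0 to y1. *)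
Lemma ext_space_onto s c u x0 x1 : ev c u = 1 ->
  ext_space [seq proj c u *m d | d <- s] x0 ->
  ext_space [seq proj c u *m d | d <- s] x1 ->
  exists y, [/\ ext_space (c :: s) y, pb (proj c u) y = x0 &
                pb (proj c u) (iprod u y) = x1].
Proof.
move=> cu /(ext_space_pb_surj K0)[y0 s0 <-] /(ext_space_pb_surj K0)[y1 s1 <-].
exists (y0 + wedge c (y1 - iprod u y0)); split.
- apply: ext_spaceD; first exact: ext_space_cons.
  by apply: ext_space_wedge => //; apply: ext_spaceB => //; apply: ext_space_iprod.
- by rewrite pbD (pb_wedge K0) (proj_b cu) wedge0l addr0.
- rewrite iprodD iprod_wedge cu scale1r addrA [iprod u y0 + _]addrC subrK.
  by rewrite pbB (pb_wedge K0) (proj_b cu) wedge0l subr0.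
Qed.

(** The difference of z and its pullback is some b x. Both are constant along v, so b D_v x + b(v) x
    = 0, which forces x = 0. *)
Lemma deg_lt1_proj b v z : ev b v = 1 -> deg_lt v 1 z -> pb (proj b v) z = z.
Proof.
move=> bv [/= Dz iz].
have [x ex] : exists x, z - pb (proj b v) z = pmul (linp b) x.
  apply: (restrict_eq0_linp K0 bv).
    by rewrite pbB (pb_comp K0) (proj_proj bv) subrr.
  by rewrite iprodB (iprod_pb K0) (proj_v bv) iprod0l pb0 iz subr0 pb0.
suff x0 : x = 0 by apply/esym/eqP; rewrite -subr_eq0 ex x0 linear0.
have := congr1 (dird v) ex; rewrite linearB /= (dird_pb K0) (proj_v bv) dird0l linear0.
rewrite Dz subr0 dird_linp => /esym e0.
by apply: (@linp_ode _ _ K0 1 v b) => //; [rewrite bv oner_eq0 | rewrite mul1r].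
Qed.

Lemma proj_absorb b v v' : ev b v = 1 -> proj b v *m proj b v' = proj b v.
Proof.
move=> bv; rewrite [proj b v']/proj mulmxBr mulmx1 mulmxA. by rewrite proj_b // mul0mx subr0.
Qed.

Lemma proj_comm b v c u : ev b u = 0 -> ev c v = 0 ->
  proj b v *m proj c u = proj c u *m proj b v.
Proof.
move=> bu cv; rewrite /proj !mulmxBl !mulmxBr !mulmx1 !mul1mx.
have -> : b *m v *m (c *m u) = 0.
  by rewrite mulmxA -[b *m v *m c]mulmxA [v *m c]mx11_scalar -/(ev c v) cv raddf0 mulmx0 mul0mx.
have -> : c *m u *m (b *m v) = 0.
  by rewrite mulmxA -[c *m u *m b]mulmxA [u *m b]mx11_scalar -/(ev b u) bu raddf0 mulmx0 mul0mx.
by rewrite !subr0 addrAC.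
Qed.

Lemma pb_proj_comm b v c u h : ev b u = 0 -> ev c v = 0 ->
  pb (proj c u) (pb (proj b v) h) = pb (proj b v) (pb (proj c u) h).
Proof.
by move=> bu cv; rewrite (pb_comp K0) -(proj_comm bu cv) -(pb_comp K0).
Qed.

Lemma iprod_pb_proj b v u h : ev b u = 0 ->
  iprod u (pb (proj b v) h) = pb (proj b v) (iprod u h).
Proof. by move=> bu; rewrite (iprod_pb K0) (proj_id v bu). Qed.

Lemma map_projM (M N : 'M[K]_r) s :
  [seq M *m d | d <- [seq N *m d | d <- s]] = [seq (M *m N) *m d | d <- s].
Proof. by rewrite -map_comp; apply: eq_map => d /=; rewrite mulmxA. Qed.

(** The projection kills v, so no form of the projected list sees it and the bound at v is the 1 of
    the maximum. *)
Lemma cen_space_deg1 s b v z : ev b v = 1 ->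
  cen_space [seq proj b v *m d | d <- s] z -> deg_lt v 1 z.
Proof.
move=> bv /(_ v); rewrite rhos_map proj_v //.
by have -> : rhos s 0 = 0 by apply/rhos_eq0P => d _; rewrite ev0r.
Qed.

Lemma cen_space_fix s b v z : ev b v = 1 ->
  cen_space [seq proj b v *m d | d <- s] z -> pb (proj b v) z = z.
Proof. by move=> bv /(cen_space_deg1 bv); apply: deg_lt1_proj. Qed.

(* b is in the span of s, but not in the span of a subset of s of smaller rank. *)
Definition generic s b :=
  (forall w, rhos s w = 0 -> ev b w = 0) /\
  (forall w, rhos s w <> 0 -> exists2 u, ev b u != 0 &
     {in s, forall c, ev c w = 0 -> ev c u = 0}).

Lemma cen_space_linp s b x : (forall w, rhos s w = 0 -> ev b w = 0) ->
  cen_space s x -> ext_space s (pmul (linp b) x).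
Proof.
move=> b0 sx w; have := deg_lt_linp b (sx w).
case: (posnP (rhos s w)) => [s0|s0].
  by rewrite s0 b0 // eqxx; apply: deg_ltW.
by rewrite (maxn_idPl s0); apply: deg_ltW; case: eqP => _; rewrite /= ?leqnSn.
Qed.

(** Along w with b(w) <> 0, division by b lowers the degree. If b(w) = 0 but some form of s is
    nonzero at w, take u in the smallest flat containing w with b(u) <> 0: D_u (b x) has degree less
    than [rhos s w] along w, D_w commutes with b, and D_u (b y) = 0 forces y = 0. *)
Lemma cen_space_of_linp s b x : b != 0 -> generic s b ->
  ext_space s (pmul (linp b) x) -> cen_space s x.
Proof.
move=> b0 [g1 g2] sx w; have := sx w.
have [s0|s0] := posnP (rhos s w).
  rewrite s0 => sx0; apply: (@deg_lt_linp_inv _ _ K0 _ _ b) => //.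
  by rewrite g1 // eqxx.
rewrite (maxn_idPl s0); have [bw|bw] := eqVneq (ev b w) 0; last first.
  by move=> sx0; apply: (@deg_lt_linp_inv _ _ K0 _ _ b) => //; rewrite bw.
move=> _; have [u bu wu] : exists2 u, ev b u != 0 &
     {in s, forall c, ev c w = 0 -> ev c u = 0}.
  by apply: g2; move=> s1; rewrite s1 in s0.
have [_ []] := ext_space_flat K0 sx wu.
have D0 y : dird u (pmul (linp b) y) = 0 -> y = 0.
  by rewrite dird_linp => e0; apply: (@linp_ode _ _ K0 1 u b) => //; rewrite mul1r.
have C m y : iter m (dird w) (dird u y) = dird u (iter m (dird w) y).
  by apply: iter_commute => y'; rewrite dirdC.
rewrite -dird_iprod iprodM !C !iter_dird_linp bw !mulr0 !scale0r !addr0.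
by move=> /D0 x0 /D0.
Qed.

(** The residue of y is the restriction to ker b of its contraction by v. As y restricts to 0, v may
    be replaced by u / b(u) for any u with b(u) <> 0; for u in the smallest flat containing w1, the
    contraction saves a degree along w1. *)
Lemma cen_space_residue s b v y : generic s b -> ev b v = 1 -> ext_space s y ->
  pb (proj b v) y = 0 ->
  cen_space [seq proj b v *m d | d <- s] (pb (proj b v) (iprod v y)).
Proof.
move=> [g1 g2] bv sy y0 w; rewrite rhos_map; set w1 := w *m proj b v.
have [s0|s0] := posnP (rhos s w1).
  rewrite s0; have := sy w1; rewrite s0 => -[/= D1 i1].
  split; rewrite /= ?(dird_pb K0) ?(iprod_pb K0) -/w1.
    by rewrite dird_iprod D1 iprod0 pb0.
  by rewrite iprodC i1 iprod0 oppr0 pb0.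
have [u bu wu] : exists2 u, ev b u != 0 &
     {in s, forall c, ev c w1 = 0 -> ev c u = 0}.
  by apply: g2; move=> s1; rewrite s1 in s0.
have [iu _] := ext_space_flat K0 sy wu.
rewrite (maxn_idPl s0).
suff -> : pb (proj b v) (iprod v y) = (ev b u)^-1 *: pb (proj b v) (iprod u y).
  by apply: deg_ltZ; apply: deg_lt_pb.
have {2}-> : u = ev b u *: v + u *m proj b v by rewrite mul_proj addrC subrK.
rewrite iprodPl linearD linearZ /= -iprod_pb // y0 linear0 addr0.
by rewrite scalerA mulVf // scale1r.
Qed.

Lemma generic_proj s b c u : generic (c :: s) b -> ev c u = 1 -> ev b u = 0 ->
  generic [seq proj c u *m d | d <- s] b.
Proof.
move=> [g1 g2] cu bu; have bP w : ev b (w *m proj c u) = ev b w.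
  by rewrite mul_proj evBr evZr bu mulr0 subr0.
split=> w; rewrite rhos_map => ws.
  by rewrite -bP; apply: g1; rewrite /= ev_proj // eqxx.
have [|u' bu' wu'] := g2 (w *m proj c u).
  by rewrite /= ev_proj // eqxx.
have cu' : ev c u' = 0 by apply: wu'; rewrite ?mem_head ?ev_proj.
exists u' => // _ /mapP[d ds ->]; rewrite !ev_mulmx (proj_id _ cu').
by apply: wu'; rewrite inE ds orbT.
Qed.

Lemma generic_behead s b c : generic (c :: s) b ->
  (forall w, rhos s w = 0 -> ev c w = 0) -> generic s b.
Proof.
move=> [g1 g2] cs; split=> w ws.
  by apply: g1; rewrite /= cs // eqxx.
have [|u bu wu] := g2 w; first by rewrite /=; case: (_ != 0).
by exists u => // d ds; apply: wu; rewrite inE ds orbT.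
Qed.

(** Modulo b, the product of db with a form depends only on the restriction of this form to ker b.
    This permits changes of the transversal vector. *)
Lemma wedge_restrict b v h : ev b v = 1 -> pb (proj b v) h = 0 ->
  exists x, wedge b h = pmul (linp b) x.
Proof.
move=> bv h0; have [h1 ->] := restrict_eq0 K0 bv h0.
by exists (wedge b h1); rewrite wedgeD wedgeM wedge2 // addr0.
Qed.

(** An arbitrary lift restricts on ker b to a multiple c x, since y0 and y1 vanish on ker b. The
    factor x obeys the bounds of the projected list, so it lifts to x', and subtracting c x' changes
    neither prescribed restriction to ker c. *)
Lemma kernel_lift s c b u v y0 y1 :
  ev c u = 1 -> ev c v = 0 -> ev b u = 0 -> ev b v = 1 ->
  ext_space [seq proj c u *m d | d <- s] y0 ->
  ext_space [seq proj c u *m d | d <- s] y1 ->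
  pb (proj b v) y0 = 0 -> pb (proj b v) y1 = 0 ->
  exists y, [/\ ext_space (c :: s) y, pb (proj b v) y = 0,
                pb (proj c u) y = y0 & pb (proj c u) (iprod u y) = y1].
Proof.
move=> cu cv bu bv s0 s1 b0 b1.
have [y [sy e0 e1]] := ext_space_onto cu s0 s1.
have [x ex] : exists x, pb (proj b v) y = pmul (linp c) x.
  apply: (restrict_eq0_linp K0 cu).
    by rewrite (pb_proj_comm _ bu cv) e0.
  by rewrite (iprod_pb_proj _ _ bu) (pb_proj_comm _ bu cv) e1.
have sx : ext_space [seq proj b v *m d | d <- s] x.
  have /= := ext_space_pb K0 (proj b v) sy.
  by rewrite proj_fix // ex; apply: ext_space_linp_inv => //; apply: neq0_of_ev cu.
have [x' sx' ex'] := ext_space_pb_surj K0 sx.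
exists (y - pmul (linp c) x'); split.
- by apply: ext_spaceB => //; apply: ext_space_linp.
- by rewrite pbB pb_linp (proj_fix _ cv) ex ex' subrr.
- by rewrite pbB pb_linp (proj_b cu) linp0 pmul0l subr0.
- by rewrite iprodB iprodM pbB pb_linp (proj_b cu) linp0 pmul0l subr0.
Qed.

(** The expression c db - b dc does not change when a multiple of b is added to c, so if b(w) <> 0
    one may assume c(w) = 0; then each term has at most one factor of positive degree along w. *)
Lemma deg_lt_lin_wedge w n c b g : deg_lt w n g ->
  deg_lt w (((ev c w != 0) || (ev b w != 0))%R + n)%N
    (pmul (linp c) (wedge b g) - pmul (linp b) (wedge c g)).
Proof.
move=> gn; have step a : (ev a w == 0) || (ev b w == 0) ->
    deg_lt w (((ev a w != 0) || (ev b w != 0))%R + n)%N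
      (pmul (linp a) (wedge b g) - pmul (linp b) (wedge a g)).
  move=> ab; have e : (((ev a w != 0)%R || (ev b w != 0)%R) + n =
      (ev a w != 0)%R + ((ev b w != 0)%R + n))%N.
    by move: ab; case: eqP => _; case: eqP => _.
  rewrite e; apply: deg_ltB; first exact/deg_lt_linp/deg_lt_wedge.
  by rewrite addnCA; apply/deg_lt_linp/deg_lt_wedge.
have [cw|cw] := eqVneq (ev c w) 0; first by have := step c; rewrite cw eqxx; apply.
have [bw|bw] := eqVneq (ev b w) 0.
  by have := step c; rewrite bw eqxx orbT (negPf cw); apply.
pose c' := - (ev c w / ev b w) *: b + c.
have c'w : ev c' w = 0.
  rewrite /c' /ev mulmxDr -scalemxAr.
  by rewrite mxE [X in X + _]mxE -!/(ev _ _) mulNr divfK // addNr.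
have := step c'; rewrite c'w eqxx bw /c' linpPl pmulDl pmulZl wedgePl linearD linearZ /=.
by rewrite opprD addrACA subrr add0r; apply.
Qed.

End CentralSpaces.

Opaque proj.

(** * Surjectivity of the residue along ker b *)

Section CentralSurjectivity.

Variables (K : fieldType) (r : nat).
Hypothesis K0 : [pchar K] =i pred0.
Implicit Types (s t : seq 'cV[K]_r) (c b : 'cV[K]_r) (u v w : 'rV[K]_r).
Implicit Types (f g h x y z : superspace K r).

(** If a form of s were nonzero at w, the smallest flat containing w would lie in ker c, hence in
    ker b, against genericity. *)
Lemma generic_ker s c b w : generic (c :: s) b ->
  (forall v', ev c v' = 0 -> ev b v' = 0) -> ev c w = 0 -> rhos s w = 0.
Proof.
move=> [_ g2] cb cw; apply: boolp.contrapT => sw.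
have [|u bu wu] := g2 w; first by rewrite /=; case: (_ != 0).
by move/eqP: bu; apply; apply: cb; apply: wu; rewrite ?mem_head.
Qed.

(* Induction on s, deleting and contracting its first form c; if c is a coloop, the
   last step multiplies by c db - b dc, which has degree at most one along any line. *)
Lemma residue_onto s b v z : generic s b -> ev b v = 1 ->
  cen_space [seq proj b v *m d | d <- s] z ->
  exists x, ext_space s (wedge b z + pmul (linp b) x).
Proof.
have [n] := ubnP (size s); elim: n s b v z => // n IHn [|c s] b v z /=.
  by move=> _ [g1 _] bv; move/eqP: (g1 v erefl); rewrite bv oner_eq0.
rewrite ltnS => ltsn gen bv.
have [c0|c0] := eqVneq c 0.
  have e w : rhos s w = rhos (c :: s) w by rewrite c0; rewrite rhos_cons0.
  move=> sz; have [||x sx] := IHn s b v z ltsn _ bv; last first.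
  - by exists x; apply: ext_space_eq sx => w; rewrite e.
  - by apply: cen_space_eq sz => w /=; rewrite c0 mulmx0 ev0l eqxx.
  have [g1 g2] := gen; split=> w; rewrite e; first exact: g1.
  by move=> /g2[u bu wu]; exists u => // d ds; apply: wu; rewrite inE ds orbT.
have [[v' [cv' bv']]|nv'] := boolp.EM (exists v', ev c v' = 0 /\ ev b v' <> 0);
  last first.
  have cb v' : ev c v' = 0 -> ev b v' = 0.
    by move=> cv'; apply: boolp.contrapT => bv'; apply: nv'; exists v'.
  (* Here b is a multiple of c. The forms of s vanish on this hyperplane, so z has degree 0 along
     every line, and db z already obeys the bounds. *)
  move=> sz; exists 0; rewrite pmul0 addr0 => w.
  have zw : deg_lt w 1 z.
    have := sz w; set m := (X in maxn X 1); suff -> : m = 0 by [].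
    rewrite {}/m -[LHS]/(rhos [seq proj b v *m d | d <- c :: s] w) rhos_map.
    have cw : ev c (w *m proj b v) = 0.
      have cv : ev c v != 0.
        by apply/eqP => /cb/eqP; rewrite bv oner_eq0.
      have: ev b (w *m proj b v - (ev c (w *m proj b v) / ev c v) *: v) = 0.
        by apply: cb; rewrite evBr evZr divfK // subrr.
      rewrite evBr ev_proj // evZr bv mulr1 sub0r => /eqP.
      by rewrite oppr_eq0 mulf_eq0 invr_eq0 (negPf cv) orbF => /eqP.
    by rewrite /= cw eqxx; apply: (generic_ker gen cb cw).
  apply: deg_ltW (deg_lt_wedge b zw); rewrite addn1 ltnS.
  have [bw|bw] := eqVneq (ev b w) 0 => //=; rewrite lt0n; apply/eqP => sw.
  by move/eqP: bw; apply; case: gen => g1 _; apply: g1.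
rewrite -[_ :: [seq _ | _ <- s]]/[seq proj b v *m d | d <- c :: s].
(* Another choice of v changes z by a form restricting to 0 on ker b, whose product with db is a
   multiple of b; so v may be taken in ker c. *)
wlog cv : v z bv / ev c v = 0.
  move=> W sz; pose v1 := (ev b v')^-1 *: v'.
  have bv1 : ev b v1 = 1 by rewrite evZr mulVf //; apply/eqP.
  have sz1 := cen_space_pb K0 (proj b v1) sz.
  rewrite map_projM [proj b v1 *m _]proj_absorb // in sz1.
  have [|x sx] := W v1 (pb (proj b v1) z) bv1 _ sz1.
    by rewrite evZr cv' mulr0.
  have [|x' ex'] := @wedge_restrict _ _ K0 b v (z - pb (proj b v1) z) bv.
    by rewrite pbB (pb_comp K0) (proj_absorb _ bv) subrr.
  exists (x - x'); suff -> : wedge b z + pmul (linp b) (x - x') =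
    wedge b (pb (proj b v1) z) + pmul (linp b) x by [].
  by rewrite pmulB -ex' wedgeB opprB addrCA [wedge b z + _]addrC subrK addrC.
rewrite /= (proj_fix _ cv) => sz.
have [u0 cu0] := exists_ev1 c0.
(* Now u, v are dual to c, b, so the two projections commute. *)
pose u := - ev b u0 *: v + u0.
have cu : ev c u = 1 by rewrite evDr evZr cv mulr0 add0r.
have bu : ev b u = 0 by rewrite evDr evZr bv mulr1 addNr.
have zfix : pb (proj b v) z = z.
  by apply: (cen_space_fix K0 (s := c :: s) bv); rewrite /= proj_fix.
have comm h := pb_proj_comm K0 h bu cv.
have iv h := iprod_pb_proj K0 u h cv.
have iu h := iprod_pb_proj K0 v h bu.
have gen' := generic_proj gen cu bu.
have resz h : cen_space (c :: [seq proj b v *m d | d <- s]) h ->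
    cen_space [seq proj b v *m d | d <- [seq proj c u *m d | d <- s]] (pb (proj c u) h).
  by move/(cen_space_proj K0 cu); rewrite !map_projM proj_comm.
(* On ker c, the restrictions of z and of its contraction by u are residues by induction. *)
have [|x0 sx0] := IHn _ b v _ _ gen' bv (resz _ sz); first by rewrite size_map.
have [|x1 sx1] := IHn _ b v _ _ gen' bv (resz _ (cen_space_iprod u sz)).
  by rewrite size_map.
set y0 := wedge b _ + _ in sx0; set y1 := wedge b _ + _ in sx1.
have py h x : pb (proj b v) (wedge b h + pmul (linp b) x) = 0.
  by rewrite pbD (pb_wedge K0) pb_linp (proj_b bv) wedge0l linp0 pmul0l addr0.
have ry h x : pb (proj b v) h = h ->
    pb (proj b v) (iprod v (wedge b h + pmul (linp b) x)) = h.
  move=> hfix; rewrite iprodD iprod_wedge bv scale1r iprodM pbD pbB (pb_wedge K0) pb_linp.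
  by rewrite (proj_b bv) wedge0l linp0 pmul0l addr0 subr0.
have ry0 : pb (proj b v) (iprod v y0) = pb (proj c u) z.
  by apply: ry; rewrite -comm zfix.
have ry1 : pb (proj b v) (iprod v y1) = pb (proj c u) (iprod u z).
  by apply: ry; rewrite -comm -iu zfix.
(* The sign comes from exchanging the contractions by u and v. *)
have sx1N := ext_spaceN sx1.
have py1N : pb (proj b v) (- y1) = 0.
  by rewrite -[- y1]sub0r pbB pb0 py subr0.
have [y [sy yb yc yuc]] := kernel_lift K0 cu cv bu bv sx0 sx1N (py _ _) py1N.
have sres := cen_space_residue K0 gen bv sy yb.
rewrite /= (proj_fix _ cv) in sres.
have [zy ezy] : exists zy, zy = pb (proj b v) (iprod v y).
  by exists (pb (proj b v) (iprod v y)); exact: erefl.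
rewrite -ezy in sres.
(* The residue of y agrees with z on ker c, also after contraction by u. It remains to realize the
   residue c z', with z' belonging to the deletion. *)
have [z' ez'] : exists z', z - zy = pmul (linp c) z'.
  apply: (restrict_eq0_linp K0 cu).
    by rewrite pbB ezy comm -(iv y) yc ry0 subrr.
  rewrite iprodB pbB ezy iu iprodC comm pbN pbN -(iv (iprod u y)) yuc iprodN pbN opprK.
  by rewrite ry1 subrr.
have sz' : cen_space [seq proj b v *m d | d <- s] z'.
  by apply: (cen_space_linp_inv K0 c0); rewrite -ez'; apply: cen_spaceB.
suff [x' sx'] : exists x', ext_space (c :: s)
    (pmul (linp c) (wedge b z') + pmul (linp b) x').
  have [h1 ey] := restrict_eq0 K0 bv yb.
  have [|h2 eh2] := @wedge_restrict _ _ K0 b v (zy - iprod v y) bv.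
    by rewrite pbB ezy (pb_comp K0) (proj_proj bv) subrr.
  exists (h1 - h2 + x').
  suff -> : wedge b z + pmul (linp b) (h1 - h2 + x') =
      y + (pmul (linp c) (wedge b z') + pmul (linp b) x') by apply: ext_spaceD.
  rewrite -wedgeM -ez' wedgeB pmulD pmulB -eh2 wedgeB {2}ey opprB !addrA.
  move: (wedge b z) (wedge b zy) (wedge b (iprod v y)) (pmul (linp b) h1) => A B C D.
  by congr (_ + _); rewrite -!addrA addrCA; congr (_ + _); rewrite addrCA.
clear - K0 IHn ltsn gen c0 bv sz'.
(* If c is not a coloop, b is still generic for s, and a solution for z' is multiplied by c. *)
have [cs|ncs] := boolp.EM (forall w, rhos s w = 0 -> ev c w = 0).
  have [x' sx'] := IHn s b v z' ltsn (generic_behead gen cs) bv sz'.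
  exists (pmul (linp c) x'); rewrite [pmul (linp b) _]pmulA [linp b * _]mulrC -pmulA.
  by rewrite -pmulD; apply: ext_space_linp.
have [w1 sw1 cw1] : exists2 w, rhos s w = 0 & ev c w <> 0.
  apply: boolp.contrapT => nw; apply: ncs => w sw; apply: boolp.contrapT => cw.
  by apply: nw; exists w.
have [g1 g2] := gen; have [|u1 bu1 wu1] := g2 w1.
  by rewrite /=; case: eqP.
(* All forms of s vanish at w1, hence at u1, so the projection along w0 fixes s and turns z' into a
   form z2 that obeys the bounds of s itself. *)
pose w0 := (ev b u1)^-1 *: u1.
have bw0 : ev b w0 = 1 by rewrite evZr mulVf.
have sw0 : {in s, forall d, ev d w0 = 0}.
  move=> d ds; rewrite evZr (wu1 d) ?mulr0 ?(in_cons, ds, orbT) //.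
  by move/rhos_eq0P: sw1; apply.
have := cen_space_pb K0 (proj b w0) sz'; rewrite map_projM proj_absorb //.
set z2 := pb _ z'; have -> : [seq proj b w0 *m d | d <- s] = s.
  by rewrite -[RHS]map_id; apply/eq_in_map => d ds; rewrite proj_fix // sw0.
move=> sz2.
have [|h eh] := @wedge_restrict _ _ K0 b v (z' - z2) bv.
  by rewrite pbB /z2 (pb_comp K0) (proj_absorb _ bv) subrr.
(* The summand c h cancels the contribution of z' - z2; what remains is c db - b dc multiplied by
   z2. *)
exists (- (pmul (linp c) h + wedge c z2)) => w.
have -> : pmul (linp c) (wedge b z') + pmul (linp b) (- (pmul (linp c) h + wedge c z2)) =
    pmul (linp c) (wedge b z2) - pmul (linp b) (wedge c z2).
  rewrite -[z'](subrK z2) wedgeD eh pmulD linearN /= pmulD !pmulA [linp b * _]mulrC.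
  by rewrite opprD addrACA subrr add0r.
apply: deg_ltW (deg_lt_lin_wedge c b (sz2 w)) => /=.
have [s0|s0] := posnP (rhos s w); last first.
  by rewrite (maxn_idPl s0) -addnS; case: (_ != 0) (_ != 0) => [] [].
rewrite s0 max0n addn0 addn1 ltnS; have [cw|//] := eqVneq (ev c w) 0.
by rewrite g1 ?eqxx //= cw eqxx s0.
Qed.

End CentralSurjectivity.

(** * Lifting for k = -1 and existence of generic forms *)

Section CentralOnto.

Variables (K : fieldType) (r : nat).
Hypothesis K0 : [pchar K] =i pred0.
Implicit Types (s t : seq 'cV[K]_r) (c b : 'cV[K]_r) (u v w : 'rV[K]_r).
Implicit Types (f g h x y z : superspace K r).

(* Lift b x0 and b x1 to ext_space (c :: s), then correct the lift by a multiple of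
   c until b divides it. *)
Lemma cen_space_onto_split s c b u v x0 x1 : generic (c :: s) b ->
  (forall w, rhos s w = 0 -> ev c w = 0) ->
  ev c u = 1 -> ev c v = 0 -> ev b u = 0 -> ev b v = 1 ->
  cen_space [seq proj c u *m d | d <- s] x0 ->
  cen_space [seq proj c u *m d | d <- s] x1 ->
  exists y, [/\ cen_space (c :: s) y, pb (proj c u) y = x0 &
                pb (proj c u) (iprod u y) = x1].
Proof.
move=> gen cs cu cv bu bv s0 s1.
have c0 := neq0_of_ev cu; have b0 := neq0_of_ev bv.
have b1 : linp b != 0 by apply: contra_neq b0 => /linp_eq0.
have gens := generic_behead gen cs.
have genP := generic_proj gen cu bu.
have comm h := pb_proj_comm K0 h bu cv.
have iv h := iprod_pb_proj K0 u h cv.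
have iu h := iprod_pb_proj K0 v h bu.
have py h : pb (proj b v) (pmul (linp b) h) = 0.
  by rewrite pb_linp (proj_b bv) linp0 pmul0l.
have sy0 := cen_space_linp (proj1 genP) s0.
have sy1 := cen_space_linp (proj1 genP) s1.
have [y [sy yb yc yuc]] := kernel_lift K0 cu cv bu bv sy0 sy1 (py _) (py _).
have sres := cen_space_residue K0 gen bv sy yb.
rewrite /= (proj_fix _ cv) in sres.
(* On ker c, y and its contraction by u are b x0 and b x1, which have zero residue; hence the
   residue of y is divisible by c. *)
have [z ez] : exists z, pb (proj b v) (iprod v y) = pmul (linp c) z.
  apply: (restrict_eq0_linp K0 cu).
    by rewrite comm -(iv y) yc iprodM py.
  by rewrite iu iprodC comm !pbN -(iv (iprod u y)) yuc iprodM py oppr0.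
rewrite ez in sres; have sz := cen_space_linp_inv K0 c0 sres.
have zfix := cen_space_fix K0 bv sz.
have [x sx] := residue_onto K0 gens bv sz.
set e := wedge b z + _ in sx.
have eb : pb (proj b v) e = 0.
  by rewrite pbD (pb_wedge K0) (proj_b bv) wedge0l py addr0.
have ebv : pb (proj b v) (iprod v e) = z.
  rewrite iprodD iprod_wedge bv scale1r iprodM pbD py pbB (pb_wedge K0) (proj_b bv).
  by rewrite wedge0l subr0 addr0.
have pc h : pb (proj c u) (pmul (linp c) h) = 0.
  by rewrite pb_linp (proj_b cu) linp0 pmul0l.
have pcb h : pb (proj b v) (pmul (linp c) h) = pmul (linp c) (pb (proj b v) h).
  by rewrite pb_linp (proj_fix _ cv).
have pbc h : pb (proj c u) (pmul (linp b) h) = pmul (linp b) (pb (proj c u) h).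
  by rewrite pb_linp (proj_fix _ bu).
(* Both y and c e restrict to 0 on ker b, and their residues agree. *)
have [y' ey'] : exists y', y - pmul (linp c) e = pmul (linp b) y'.
  apply: (restrict_eq0_linp K0 bv).
    by rewrite pbB yb pcb eb pmul0 subr0.
  by rewrite iprodB iprodM pbB ez pcb ebv subrr.
exists y'; split.
- apply: (cen_space_of_linp K0 b0 gen); rewrite -ey'.
  exact: ext_spaceB sy (ext_space_linp c sx).
- by apply: (pmul_inj b1); rewrite -pbc -ey' pbB yc pc subr0.
- by apply: (pmul_inj b1); rewrite -pbc -iprodM -ey' iprodB iprodM pbB yuc pc subr0.
Qed.

(** Unless ker c lies in ker b, u is moved inside its coset of ker c to u' = u - b(u) v with b(u') =
    0. The contraction to be prescribed becomes x1 minus b(u) times the contraction of x0 by v. *)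
Lemma cen_space_onto s c b u x0 x1 : generic (c :: s) b ->
  (forall w, rhos s w = 0 -> ev c w = 0) -> ev c u = 1 ->
  cen_space [seq proj c u *m d | d <- s] x0 ->
  cen_space [seq proj c u *m d | d <- s] x1 ->
  exists y, [/\ cen_space (c :: s) y, pb (proj c u) y = x0 &
                pb (proj c u) (iprod u y) = x1].
Proof.
move=> gen cs cu s0 s1.
have f0 := cen_space_fix K0 cu s0; have f1 := cen_space_fix K0 cu s1.
have [[v' [cv' bv']]|nv'] := boolp.EM (exists v', ev c v' = 0 /\ ev b v' <> 0);
  last first.
  have cb v' : ev c v' = 0 -> ev b v' = 0.
    by move=> cv'; apply: boolp.contrapT => bv'; apply: nv'; exists v'.
  have deg1 w x : cen_space [seq proj c u *m d | d <- s] x -> deg_lt w 1 x.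
    move/(_ w); rewrite rhos_map (generic_ker gen cb) //; exact: ev_proj.
  (* The other forms vanish on ker c, so x0 and x1 have degree 0 in every direction. Where c is
     nonzero, some form of s is nonzero as well, which leaves room for dc. *)
  exists (x0 + wedge c x1); split.
  - move=> w; have [cw|cw] := eqVneq (ev c w) 0.
      apply: deg_ltD.
        by apply: (deg_ltW _ (deg1 w _ s0)); rewrite leq_maxr.
      have := deg_lt_wedge c (deg1 w _ s1); rewrite cw eqxx.
      by apply: deg_ltW; rewrite leq_maxr.
    have s2 : (1 < maxn (rhos (c :: s) w) 1)%N.
      rewrite /= cw add1n leq_max ltnS lt0n; apply/orP; left; apply/eqP => sw.
      by move/eqP: cw; apply; apply: cs.
    apply: deg_ltD; first exact: (deg_ltW (ltnW s2) (deg1 w _ s0)).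
    apply: (deg_ltW _ (deg_lt_wedge c (deg1 w _ s1))).
    by rewrite cw.
  - by rewrite pbD f0 (pb_wedge K0) (proj_b cu) wedge0l addr0.
  - have [_ /= i0] := deg1 u _ s0.
    rewrite iprodD i0 add0r iprod_wedge cu scale1r pbB f1 (pb_wedge K0) (proj_b cu).
    by rewrite wedge0l subr0.
pose v := (ev b v')^-1 *: v'.
have cv : ev c v = 0 by rewrite evZr cv' mulr0.
have bv : ev b v = 1 by rewrite evZr mulVf //; apply/eqP.
pose u' := - ev b u *: v + u.
have cu' : ev c u' = 1 by rewrite evDr evZr cv mulr0 add0r.
have bu' : ev b u' = 0 by rewrite evDr evZr bv mulr1 addNr.
have absorb h : pb (proj c u) (pb (proj c u') h) = pb (proj c u) h.
  by rewrite (pb_comp K0) (proj_absorb _ cu).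
have sP h : cen_space [seq proj c u *m d | d <- s] h ->
    cen_space [seq proj c u' *m d | d <- s] (pb (proj c u') h).
  by move/(cen_space_pb K0 (proj c u')); rewrite map_projM (proj_absorb _ cu').
have s1' := cen_spaceB s1 (cen_spaceZ (ev b u) (cen_space_iprod v s0)).
have [y [sy y0 y1]] :=
  cen_space_onto_split gen cs cu' cv bu' bv (sP _ s0) (sP _ s1').
exists y; split; [exact: sy|by rewrite -absorb y0 absorb|].
have eu : u = ev b u *: v + u' by rewrite /u' addrA scaleNr addrN add0r.
have iv h := iprod_pb_proj K0 u h cv.
rewrite [X in iprod X y]eu iprodPl pbD -[pb _ (iprod u' y)]absorb y1 absorb.
rewrite pbB f1 linearZ [X in _ - X]linearZ /= -!iv -[pb _ y]absorb y0 absorb f0.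
by rewrite addrC subrK.
Qed.

(** The form (1, a, a^2, ...) evaluates at a the polynomial with coefficients w. A product of
    finitely many nonzero polynomials has a nonroot among 0, 1, 2, ..., which are distinct in K. *)
Lemma exists_ev_neq0 (ws : seq 'rV[K]_r) :
  exists b, forall w, w \in ws -> w != 0 -> ev b w != 0.
Proof.
pose P := \prod_(w <- ws | w != 0) rVpoly w.
have P0 : P != 0.
  rewrite /P prodf_seq_neq0; apply/allP=> w _; apply/implyP.
  by apply: contra_neq => /(congr1 (poly_rV (d := r))); rewrite rVpolyK linear0.
have [a Pa] : exists a : K, P.[a] != 0.
  pose ts : seq K := [seq i%:R | i <- seq.iota 0 (size P)].
  have uts : uniq ts.
    rewrite map_inj_uniq ?iota_uniq // => i j.
    wlog lij : i j / (i <= j)%N => [W e|/esym/eqP].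
      by case/orP: (leq_total i j) => l; [|apply/esym]; apply: W.
    rewrite -subr_eq0 -natrB //; move/pcharf0P: K0 => ->; rewrite subn_eq0 => lji.
    by apply/eqP; rewrite eqn_leq lij.
  apply: boolp.contrapT => nt; have := max_poly_roots P0 _ uts.
  rewrite size_map size_iota ltnn => /(_ _)/notF; apply.
  apply/allP=> a _; rewrite /root; apply: boolp.contrapT => Pa.
  by apply: nt; exists a; apply/negP.
exists (\col_i a ^+ i) => w ws_w w0; apply: contraNneq Pa => ew.
rewrite /P horner_prod (big_rem w) //= w0.
have -> : (rVpoly w).[a] = ev (\col_i a ^+ i) w.
  rewrite (horner_coef_wide _ (size_poly _ _)) evE; apply: eq_bigr => i _.
  by rewrite coef_rVpoly_ord mxE.
by rewrite ew mul0r.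
Qed.

(** There are finitely many flats, and it is enough that b be nonzero at one chosen nonzero vector
    of each nonzero flat. *)
Lemma exists_generic s : (forall w, rhos s w = 0 -> w = 0) -> exists b, generic s b.
Proof.
move=> ess.
pose flat (J : {set 'I_(size s)}) w := forall j, j \in J -> ev (nth 0 s j) w = 0.
have pick J : exists w, (exists2 w', flat J w' & w' != 0) -> flat J w /\ w != 0.
  have [[w' ? ?]|nw] := boolp.EM (exists2 w', flat J w' & w' != 0); first by exists w'.
  by exists 0.
have [f fP] := boolp.choice pick.
have [b bP] := exists_ev_neq0 [seq f J | J : {set 'I_(size s)}].
exists b; split=> w sw; first by rewrite (ess _ sw) ev0r.
have w0 : w != 0.
  by apply/eqP=> w0; apply: sw; apply/rhos_eq0P => c _; rewrite w0 ev0r.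
pose J := [set j : 'I_(size s) | ev (nth 0 s j) w == 0].
have [|fJ fJ0] := fP J.
  by exists w => // j; rewrite inE => /eqP.
exists (f J); first by apply: bP => //; apply: image_f.
move=> c /(nthP 0)[j js <-] cw; apply: (fJ (Ordinal js)).
by rewrite inE /= cw.
Qed.

End CentralOnto.

(** * Deletion and contraction *)

Section ArrangementCoordinates.

Variable K : fieldType.

Section Arrangement.

Variables (V : vectType K) (n : nat).
Implicit Types (l : arrangement V n) (v : V).

Lemma rhoE l v : rho l v = (\sum_(j < n) (l j v != 0)%R)%N.
Proof.
rewrite /rho cardsE -sum1_card big_mkcond; apply: eq_bigr => j _.
by rewrite -[j \in _]/(v \notin hyp l j) memv_ker; case: eqP.
Qed.

Definition arr l : seq 'cV[K]_(\dim {:V}) := [seq fcol (l j) | j <- enum 'I_n].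

Lemma rhos_arr l v : rhos (arr l) (rv v) = rho l v.
Proof.
rewrite rhoE /rhos count_map -sum1_count big_mkcond big_enum.
by apply: eq_bigr => j _; rewrite /= ev_fcol; case: eqP.
Qed.

(** Exponents are truncated at 0, where [deg_lt] leaves only the zero form, as the unit ideal
    does. *)
Definition natz (e : int) : nat := if 0 <= e then `|e|%N else 0.

Lemma power_genE v e : power_gen v e = sym1 (vcoord v) ^+ natz e.
Proof. by rewrite /power_gen /natz; case: ifP. Qed.

Lemma zonotopal_CP (K0 : [pchar K] =i pred0) l k (g : Psi_dual V) :
  zonotopal_C l k g <->
  forall v, v != 0 -> deg_lt (rv v) (natz ((rho l v)%:Z + k + 1)) g.
Proof.
rewrite -(@inverse_systemP _ _ K0 V (fun v => v != 0) (@vcoord K V)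
  (fun v => natz ((rho l v)%:Z + k + 1))) /zonotopal_C /zonotopal_ideal.
set G := (fun p => _); set G' := (fun p => _); suff -> : G = G' by [].
apply: boolp.funext => p; apply: boolp.propext.
by split=> -[v v0 ->]; exists v; rewrite // power_genE.
Qed.

Lemma zonotopal_ext (K0 : [pchar K] =i pred0) l s (g : Psi_dual V) :
  (forall v, rhos s (rv v) = rho l v) -> zonotopal_C l 0 g <-> ext_space s g.
Proof.
move=> sl; have e v : natz ((rho l v)%:Z + 0 + 1) = (rhos s (rv v)).+1.
  by rewrite sl addr0 -PoszD addn1.
rewrite zonotopal_CP //; split=> [gC x|gC v v0]; last by rewrite e.
have [v ->] := rv_surj x; rewrite -e; have [->|] := eqVneq v 0; last exact: gC.
by rewrite linear0 e; apply: deg_lt_null.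
Qed.

(** For v <> 0 the exponent is rho(v), positive by essentiality, so it equals its maximum with 1; at
    v = 0 the bound 1 holds for every form. *)
Lemma zonotopal_cen (K0 : [pchar K] =i pred0) l s (g : Psi_dual V) :
  (forall v, rhos s (rv v) = rho l v) -> (forall v, rho l v = 0 -> v = 0) ->
  zonotopal_C l (-1) g <-> cen_space s g.
Proof.
move=> sl ess; have e v : v != 0 ->
    natz ((rho l v)%:Z - 1 + 1) = maxn (rhos s (rv v)) 1.
  move=> v0; rewrite sl subrK (maxn_idPl _) // lt0n.
  by apply: contra_neq v0; apply: ess.
rewrite zonotopal_CP //; split=> [gC x|gC v v0]; last by rewrite e.
have [v ->] := rv_surj x; have [->|v0] := eqVneq v 0.
  have -> : rhos s (rv 0) = 0 by rewrite linear0; apply/rhos_eq0P => d _; apply: ev0r.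
  by rewrite linear0; apply: deg_lt_null.
by rewrite -e //; apply: gC.
Qed.

End Arrangement.

Lemma memv_bigcap (V : vectType K) n (P : pred 'I_n) (U : 'I_n -> {vspace V}) v :
  (forall j, P j -> v \in U j) -> v \in (\bigcap_(j | P j) U j)%VS.
Proof.
move=> vU; elim/big_ind: _ => [|A B vA vB|]; first exact: memvf.
  by rewrite memv_cap vA.
exact: vU.
Qed.

Section DeletionContraction.

Variables (V : vectType K) (n : nat) (l : arrangement V n) (i : 'I_n).

Lemma rho_deletion v : rho l v = ((l i v != 0)%R + rho (deletion l i) v)%N.
Proof. by rewrite !rhoE (bigD1_ord i). Qed.

Lemma inclE (w : subvs_of (hyp l i)) : incl (hyp l i) w = vsval w.
Proof. by rewrite lfunE. Qed.

Lemma hyp_incl (w : subvs_of (hyp l i)) : l i (vsval w) = 0.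
Proof. by apply/eqP; rewrite -memv_ker subvsP. Qed.

Lemma rho_contraction w : rho (contraction l i) w = rho (deletion l i) (vsval w).
Proof.
rewrite !rhoE; apply: eq_bigr => j _.
by rewrite /contraction comp_lfunE inclE.
Qed.

Lemma arr_contraction :
  arr (contraction l i) = [seq mxhom (incl (hyp l i)) *m c | c <- arr (deletion l i)].
Proof.
rewrite /arr -[RHS]map_comp; apply: eq_map => j /=.
by rewrite mxhom_fcol.
Qed.

Lemma rhos_arr_deletion v :
  rhos (fcol (l i) :: arr (deletion l i)) (rv v) = rho l v.
Proof. by rewrite /= ev_fcol -/(rhos _ _) rhos_arr rho_deletion. Qed.

End DeletionContraction.

End ArrangementCoordinates.

(** * The sequence of a fixed hyperplane *)

Section DeletionContractionSequence.

Variables (K : fieldType) (V : vectType K) (n : nat) (l : arrangement V n) (i : 'I_n).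
Hypothesis K0 : [pchar K] =i pred0.
Variable v : V.
Hypothesis liv : l i v != 0.

Notation H := (hyp l i).
Notation c := (fcol (l i)).
Notation J := (mxhom (incl H)).
Notation d := (ev c (rv v)).
Notation u := (d^-1 *: rv v).
Notation res := (@restrict_form K V H).

Lemma d_neq0 : d != 0.
Proof. by rewrite ev_fcol. Qed.

Lemma ev_cu : ev c u = 1.
Proof. by rewrite evZr mulVf // d_neq0. Qed.

Lemma iprod_u h : iprod u h = d^-1 *: iprod (rv v) h.
Proof. by rewrite -[u]addr0 iprodPl iprod0l addr0. Qed.

Lemma c_neq0 : c != 0.
Proof. exact: neq0_of_ev ev_cu. Qed.

Lemma J_c : J *m c = 0.
Proof.
rewrite mxhom_fcol; apply/colP=> k; rewrite !mxE /form_coord comp_lfunE inclE.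
exact: hyp_incl.
Qed.

Lemma J_free : row_free J.
Proof.
apply: inj_row_free => x; have [w ->] := rv_surj x; rewrite rv_mxhom inclE.
move/eqP; rewrite rv_eq0 => /eqP w0; apply/eqP; rewrite rv_eq0.
by apply/eqP/subvs_inj; rewrite w0 linear0.
Qed.

Lemma proj_sub_J : (proj c u <= J)%MS.
Proof.
apply/row_subP=> k; rewrite rowE; set x := _ *m _.
have cx : ev c x = 0 by apply: ev_proj ev_cu _.
have [w ew] := rv_surj x; rewrite ew in cx *.
have wH : w \in H by rewrite memv_ker -ev_fcol cx.
by rewrite -(vsprojK wH) -inclE -rv_mxhom submxMl.
Qed.

(** The projection of L onto H along v, in coordinates of H. Pullback along it extends forms from H
    to L, and restriction undoes it. *)
Definition retract := proj c u *m pinvmx J.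

Lemma retract_J : retract *m J = proj c u.
Proof. exact: mulmxKpV proj_sub_J. Qed.

Lemma J_proj : J *m proj c u = J.
Proof. by rewrite [proj c u]/(1%:M - c *m u) mulmxBr mulmx1 mulmxA J_c mul0mx subr0. Qed.

Lemma J_retract : J *m retract = 1%:M.
Proof. by rewrite mulmxA J_proj; apply: mulmxVp J_free. Qed.

Lemma resE g : res g = pb J g.
Proof. exact: pullbackE. Qed.

Lemma res_eq0 g : res g = 0 -> pb (proj c u) g = 0.
Proof. by rewrite resE -retract_J -(pb_comp K0) => ->; rewrite pb0. Qed.

Lemma res_mul_form g : res (mul_form (l i) g) = 0.
Proof. by rewrite resE mul_formE pb_linp J_c linp0 pmul0l. Qed.

Lemma natzD (e : bool) (x : int) : 0 <= x -> natz (e%:Z + x) = (e + natz x)%N.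
Proof. by case: x => // x _; rewrite -PoszD. Qed.

Lemma natz_lt0 (e : bool) (x : int) : x < 0 -> natz (e%:Z + x) = 0.
Proof. by case: x e => // -[|x] [] _. Qed.

Lemma rho_exponent k w :
  (rho l w)%:Z + k + 1 = (l i w != 0)%:Z + ((rho (deletion l i) w)%:Z + k + 1).
Proof. by rewrite (rho_deletion l i) PoszD -!addrA. Qed.

(** Deleting i lowers the exponent at w by the 0 or 1 by which division by l_i lowers the degree. If
    the exponent of the deletion is negative, both exponents truncate to 0 and both conditions force
    g = 0. *)
Lemma zonotopal_mul k (g : Psi_dual V) :
  zonotopal_C (deletion l i) k g <-> zonotopal_C l k (mul_form (l i) g).
Proof.
have c1 : linp c != 0 by apply: contra_neq c_neq0 => /linp_eq0.
rewrite !zonotopal_CP // mul_formE; split=> gC w w0; have := gC w w0;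
  rewrite rho_exponent; set x := (_ + _ + 1); rewrite -ev_fcol;
  have [x0|x0] := lerP 0 x.
- by rewrite natzD //; apply: deg_lt_linp.
- have := natz_lt0 false x0; rewrite add0r => -> /deg_lt0P ->.
  by rewrite pmul0; apply: deg_lt_0.
- by rewrite natzD //; apply: deg_lt_linp_inv c_neq0.
- rewrite natz_lt0 // => /deg_lt0P g0; have -> : g = 0; last exact: deg_lt_0.
  by apply: (pmul_inj c1); rewrite g0 pmul0.
Qed.

Lemma zonotopal_res k (g : Psi_dual V) :
  zonotopal_C l k g -> zonotopal_C (contraction l i) k (res g).
Proof.
rewrite !zonotopal_CP // resE => gC w w0; apply: (deg_lt_pb K0).
rewrite rv_mxhom inclE; have := gC (vsval w); rewrite rho_exponent.
rewrite hyp_incl eqxx add0r rho_contraction; apply.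
by apply: contra_neq w0 => w0; apply: subvs_inj; rewrite w0 linear0.
Qed.

Lemma zonotopal_contract k (g : Psi_dual V) :
  zonotopal_C l k g -> zonotopal_C l k (contract v g).
Proof. by rewrite !zonotopal_CP // contractE => gC w w0; apply/deg_lt_iprod/gC. Qed.

Lemma zonotopal_left_exact k a b :
  left_exact (zonotopal_Cab (deletion l i) k (a - 1) b) (zonotopal_Cab l k a b)
    (dsum (zonotopal_Cab (contraction l i) k a b)
          (zonotopal_Cab (contraction l i) k a (b - 1)))
    (mul_form (l i) : Psi_dual V -> Psi_dual V)
    (fun g => (res g, res (contract v g))).
Proof.
have c1 : linp c != 0 by apply: contra_neq c_neq0 => /linp_eq0.
split.
- move=> x [xC /bihomogeneousP xab]; split; first exact: (proj1 (zonotopal_mul k x) xC).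
  by apply/bihomogeneousP; rewrite mul_formE bicomp_linp xab.
- move=> y [yC /bihomogeneousP yab]; split; split.
  + exact: zonotopal_res.
  + by apply/bihomogeneousP; rewrite /= resE (bicomp_pb K0) yab.
  + exact/zonotopal_res/zonotopal_contract.
  + apply/bihomogeneousP; rewrite /= resE (bicomp_pb K0) contractE.
    by rewrite -iprod_bicomp yab.
- by move=> x x' _ _; rewrite !mul_formE => /(pmul_inj c1).
move=> y [yC /bihomogeneousP yab]; split=> [[/res_eq0 y0 /res_eq0 y1]|[x _ <-]].
  have [|x ex] := restrict_eq0_linp K0 ev_cu y0.
    by rewrite iprod_u linearZ /= -contractE y1 scaler0.
  exists x; last by rewrite mul_formE.
  split; first by apply/zonotopal_mul; rewrite mul_formE -ex.
  (* Multiplication by l_i is injective and has bidegree (1, 0), so the quotient is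
     bihomogeneous. *)
  apply/bihomogeneousP; apply: (pmul_inj c1).
  by rewrite -bicomp_linp -ex.
congr pair; first exact: res_mul_form.
by rewrite contractE mul_formE iprodM -mul_formE; apply: res_mul_form.
Qed.

(** Restriction and contraction are homogeneous and degree bounds pass to bihomogeneous components,
    so the component of an ungraded lift is a lift. *)
Lemma zonotopal_onto_of k a b :
  (forall z0 z1 : superspace K _,
     zonotopal_C (contraction l i) k z0 -> zonotopal_C (contraction l i) k z1 ->
     exists y, [/\ zonotopal_C l k y, pb (proj c u) y = pb retract z0 &
                   pb (proj c u) (iprod u y) = pb retract z1]) ->
  onto (zonotopal_Cab l k a b)
    (dsum (zonotopal_Cab (contraction l i) k a b)
          (zonotopal_Cab (contraction l i) k a (b - 1)))
    (fun g => (res g, res (contract v g))).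
Proof.
move=> lift [z0 z1] [/= [C0 /bihomogeneousP h0] [C1 /bihomogeneousP h1]].
(* The scalar appears because u is v divided by l_i(v). *)
have C1' : zonotopal_C (contraction l i) k (d^-1 *: z1 : superspace K _).
  by move: C1; rewrite !zonotopal_CP // => C1 w w0; apply/deg_ltZ/C1.
have [y [yC y0 y1]] := lift z0 _ C0 C1'.
have resP g z : pb (proj c u) g = pb retract z -> pb J g = z.
  move=> e; have := congr1 (pb J) e.
  by rewrite !(pb_comp K0) J_proj J_retract (pb1 K0).
have e1 : pb J (iprod (rv v) y) = z1.
  apply: resP; move: y1; rewrite iprod_u !linearZ /= => /(scalerI (invr_neq0 d_neq0)).
  by [].
exists (bicomp a b y); first split.
- by move: yC; rewrite !zonotopal_CP // => yC w w0; apply/deg_lt_bicomp/yC.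
- apply/bihomogeneousP/ffunP=> S; rewrite !ffunE; case: ifP => e; rewrite ?e //.
  by apply/mpolyP=> m; rewrite !mcoeff_pihomz; case: ifP => e'; rewrite ?e'.
- congr pair; rewrite resE.
    by rewrite -(bicomp_pb K0) (resP _ _ y0) h0.
  by rewrite contractE iprod_bicomp -(bicomp_pb K0) e1 h1.
Qed.

Lemma retract_arr :
  [seq retract *m d | d <- arr (contraction l i)] =
  [seq proj c u *m d | d <- arr (deletion l i)].
Proof.
rewrite arr_contraction -map_comp; apply: eq_map => d /=.
by rewrite mulmxA retract_J.
Qed.

Lemma zonotopal_onto_ext a b :
  onto (zonotopal_Cab l 0 a b)
    (dsum (zonotopal_Cab (contraction l i) 0 a b)
          (zonotopal_Cab (contraction l i) 0 a (b - 1)))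
    (fun g => (res g, res (contract v g))).
Proof.
apply: zonotopal_onto_of => z0 z1.
rewrite !(zonotopal_ext K0 _ (rhos_arr (contraction l i))) => s0 s1.
have := ext_space_pb K0 retract s0; have := ext_space_pb K0 retract s1.
rewrite retract_arr => s1' s0'.
have [y [sy y0 y1]] := ext_space_onto K0 ev_cu s0' s1'.
by exists y; split=> //; apply/(zonotopal_ext K0 _ (rhos_arr_deletion l i)).
Qed.

Lemma zonotopal_onto_cen a b : (forall w, rho (deletion l i) w = 0 -> w = 0) ->
  onto (zonotopal_Cab l (-1) a b)
    (dsum (zonotopal_Cab (contraction l i) (-1) a b)
          (zonotopal_Cab (contraction l i) (-1) a (b - 1)))
    (fun g => (res g, res (contract v g))).
Proof.
move=> ncl; have ess w : rho l w = 0 -> w = 0.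
  by rewrite (rho_deletion l i) => /eqP; rewrite addn_eq0 => /andP[_ /eqP/ncl].
have ess' w : rho (contraction l i) w = 0 -> w = 0.
  by rewrite rho_contraction => /ncl w0; apply: subvs_inj; rewrite w0 linear0.
have [b' gen] : exists b', generic (c :: arr (deletion l i)) b'.
  apply: (exists_generic K0) => x; have [w ->] := rv_surj x.
  by rewrite (rhos_arr_deletion l i) => /ess ->; rewrite linear0.
have cs x : rhos (arr (deletion l i)) x = 0 -> ev c x = 0.
  by have [w ->] := rv_surj x; rewrite rhos_arr => /ncl ->; rewrite linear0 ev0r.
apply: zonotopal_onto_of => z0 z1.
rewrite !(zonotopal_cen K0 _ (rhos_arr (contraction l i)) ess') => s0 s1.
have := cen_space_pb K0 retract s0; have := cen_space_pb K0 retract s1.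
rewrite retract_arr => s1' s0'.
have [y [sy y0 y1]] := cen_space_onto K0 gen cs ev_cu s0' s1'.
by exists y; split=> //; apply/(zonotopal_cen K0 _ (rhos_arr_deletion l i) ess).
Qed.

End DeletionContractionSequence.

Theorem theorem1p6 (R : realType) (L : vectType R[i]) (n : nat)
    (l : arrangement L n) (k : int) (i : 'I_n) (v : L)
    (l_essential : essential l)
    (k_le0 : k <= 0)
    (i_not_loop : ~ loop l i)
    (i_not_coloop : ~ coloop l i)
    (* v spans the complement of L/i = H_i in the chosen splitting *)
    (v_splitting : ({:L} = hyp l i + <[v]>)%VS /\ (hyp l i :&: <[v]> = 0)%VS) :
  let C_del := zonotopal_Cab (deletion l i) k in
  let C_L := zonotopal_Cab l k in
  let C_con := zonotopal_Cab (contraction l i) k in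
  let mul_l : Psi_dual L -> Psi_dual L := mul_form (l i) in
  let res : Psi_dual L -> Psi_dual (subvs_of (hyp l i)) := @restrict_form _ L (hyp l i) in
  let res2 g := (res g, res (contract v g)) in
  (forall a b : int,
     left_exact (C_del (a - 1) b) (C_L a b)
       (dsum (C_con a b) (C_con a (b - 1))) mul_l res2) /\
  (k = -1 \/ k = 0 ->
   forall a b : int,
     onto (C_L a b) (dsum (C_con a b) (C_con a (b - 1))) res2).
Proof.
have K0 : [pchar R[i]] =i pred0 by apply: pchar_num.
(* Otherwise H_i contains both summands of L, and i is a loop. *)
have liv : l i v != 0.
  apply/eqP=> liv; apply: i_not_loop; apply/lfunP=> w; rewrite lfunE /=.
  have [full _] := v_splitting; have vH : (<[v]> <= hyp l i)%VS.
    by rewrite -memvE memv_ker liv.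
  have: w \in (hyp l i + <[v]>)%VS by rewrite -full memvf.
  by rewrite (addv_idPl vH) memv_ker => /eqP.
move=> C_del C_L C_con mul_l res res2; split.
  by move=> a b; apply: (zonotopal_left_exact K0 liv).
(* As i is not a coloop, the deletion is essential. *)
have ncl w : rho (deletion l i) w = 0 -> w = 0.
  move=> w0; have capi : (\bigcap_(j | j != i) hyp l j)%VS = 0%VS.
    exact: boolp.contrapT.
  apply/eqP; rewrite -memv0 -capi; apply: memv_bigcap => j.
  case: (unliftP i j) => [j' ->|->]; last by rewrite eqxx.
  move=> _; rewrite memv_ker; move: w0; rewrite rhoE => /eqP.
  by rewrite sum_nat_eq0 => /forallP/(_ j')/=; rewrite eqb0 negbK.
move=> k01 a b; rewrite /C_L /C_con.
by case: k01 => ->; [apply: zonotopal_onto_cen | apply: zonotopal_onto_ext].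
Qed.
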